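(* Let $(\Gamma,\Gamma')$ be a relatively hyperbolic group-pair. Then there is $n\in\mathbb N$ such that, for every $m>n$ and every bounded $\Gamma$-module $V$, $$H^m(\Gamma,\Gamma';V)=0.$$
   Context: **Group-pairs and modules.** A group-pair $(\Gamma,\Gamma')$ is a group $\Gamma$ with a finite non-empty parametrized family $\Gamma'=\{\Gamma_i\}_{i\in I}$ of subgroups (repetitions allowed). A bounded $\Gamma$-module is a real normed space $V$ with a linear $\Gamma$-action for which there is $L>0$ with $\|\gamma v\|\le L\|v\|$ for all $\gamma\in\Gamma$, $v\in V$. **Relative cohomology.** Let $I\Gamma=\Gamma\times I$, with $\Gamma$ acting by left translation on the first factor. For $k\ge0$ let $\mathrm{St}_k$ be the real vector space with basis $(I\Gamma)^{k+1}$ (and $\mathrm{St}_k=0$ for $k<0$), with diagonal $\Gamma$-action and boundary $\partial(s_0,\dots,s_k)=\sum_{j=0}^k(-1)^j(s_0,\dots,\hat s_j,\dots,s_k)$. Let $\mathrm{St}'_*\subseteq\mathrm{St}_*$ be the subcomplex spanned by the tuples $(x_0,\dots,x_k)$ for which there is $i\in I$ with $x_j\in\Gamma\times\{i\}$ for all $j$ and $x_j\in x_0\Gamma_i$ for all $j$. Put $\mathrm{St}^{\mathrm{rel}}_*=\mathrm{St}_*/\mathrm{St}'_*$. Then $H^*(\Gamma,\Gamma';V)$ is the cohomology of the cocomplex of all (not necessarily bounded) $\Gamma$-equivariant linear maps $\mathrm{St}^{\mathrm{rel}}_*\to V$. **Relative hyperbolicity.** Let $\Gamma$ and all $\Gamma_i$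 be finitely generated. A finite symmetric generating set $S\not\ni1$ of $\Gamma$ is compatible if $S\cap\Gamma_i$ generates $\Gamma_i$ for every $i$. The cusped graph is the simplicial graph with vertices $(g,i,n)$, $g\in\Gamma$, $i\in I$, $n\in\mathbb N$, where $(g,i,0)$ and $(g,j,0)$ are identified for all $i,j$, and with the following edges: height-$0$ vertices $g,h$ are joined iff $g^{-1}h\in S$; $(g,i,n)$ and $(g,i,n+1)$ are joined for all $n\ge0$; for $n\ge1$, distinct $(g,i,n),(h,i,n)$ are joined iff $g\Gamma_i=h\Gamma_i$ and the word distance $d_{S\cap\Gamma_i}(1,g^{-1}h)$ in $\Gamma_i$ is at most $2^n$. The pair is relatively hyperbolic if $\Gamma$ and all $\Gamma_i$ are finitely generated and the cusped graph, with its graph metric, is Gromov hyperbolic (for a compatible $S$; this does not depend on the choice). *)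

(* Defs.v *)
From HB Require Import structures.
From mathcomp Require Import all_boot all_order all_algebra.
From mathcomp Require Import finmap.
From mathcomp Require Import boolp classical_sets functions reals.
From mathcomp Require Import topology normedtype.
From mathcomp Require Import freeg.

Set Implicit Arguments.
Unset Strict Implicit.
Unset Printing Implicit Defensive.

Import Order.TTheory GRing.Theory Num.Theory.
Import numFieldNormedType.Exports.

Local Open Scope ring_scope.
Local Open Scope quotient_scope.

Section Subspaces.
Context (R : pzRingType).

(* [submodClosed V] does not provide closure under opposites, which the
   quotients [Quotient.quot] require; hence this bundling. *)
Record subspace (V : lmodType R) := Subspace {
  subspace_pred :> {pred V};
  subspace_closed : submod_closed subspace_pred }.

HB.instance Definition _ (V : lmodType R) (W : subspace V) :=
  GRing.isSubmodClosed.Build R V (subspace_pred W)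
    (GRing.submod_closed_semi (subspace_closed W)).

Definition subspace_type (V : lmodType R) (W : subspace V) :=
  {x : V | x \in subspace_pred W}.

HB.instance Definition _ (V : lmodType R) (W : subspace V) :=
  SubChoice.on (subspace_type W).
HB.instance Definition _ (V : lmodType R) (W : subspace V) :=
  [SubChoice_isSubLmodule of subspace_type W by <:].

End Subspaces.

Section QuotientSpaces.
Context (R : pzRingType) (V : lmodType R) (W : subspace V).

Definition quot_space := Quotient.quot (subspace_pred W).

HB.instance Definition _ := GRing.Zmodule.on quot_space.
HB.instance Definition _ := EqQuotient.on quot_space.

Lemma quot_space_eq (x y : V) : (x - y \in W) = (x == y %[mod quot_space]).
Proof. exact: Quotient.idealrBE. Qed.

Definition quot_scale (a : R) : quot_space -> quot_space :=
  lift_op1 quot_space ( *:%R a).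

Lemma pi_quot_scale a : {morph \pi : x / a *: x >-> quot_scale a x}.
Proof.
move=> x; unlock quot_scale; apply/eqP; rewrite -quot_space_eq -scalerBr.
by rewrite rpredZ// quot_space_eq reprK.
Qed.
Canonical pi_quot_scale_morph a := PiMorph1 (pi_quot_scale a).

Lemma quot_scaleA a b x : quot_scale a (quot_scale b x) = quot_scale (a * b) x.
Proof. by rewrite -[x]reprK !piE scalerA. Qed.

Lemma quot_scale1 : left_id 1 quot_scale.
Proof. by move=> x; rewrite -[x]reprK !piE scale1r. Qed.

Lemma pi_quotD (x y : V) :
  \pi_quot_space (x + y) = \pi_quot_space x + \pi_quot_space y.
Proof. exact: (Quotient.pi_add (subspace_pred W)). Qed.

Lemma quot_scaleDr : right_distributive quot_scale +%R.
Proof.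
move=> a x y; rewrite -[x]reprK -[y]reprK -pi_quotD -!pi_quot_scale scalerDr.
exact: pi_quotD.
Qed.

Lemma quot_scaleDl x : {morph quot_scale^~ x : a b / a + b}.
Proof.
move=> a b; rewrite -[x]reprK -!pi_quot_scale scalerDl.
exact: pi_quotD.
Qed.

HB.instance Definition _ := GRing.Zmodule_isLmodule.Build R quot_space
  quot_scaleA quot_scale1 quot_scaleDr quot_scaleDl.

Lemma pi_quot_linear : linear (\pi_quot_space : V -> quot_space).
Proof. by move=> a x y; rewrite pi_quotD pi_quot_scale. Qed.

End QuotientSpaces.

Section QuotientMaps.
Context (R : pzRingType) (V V' : lmodType R).
Context (W : subspace V) (W' : subspace V').

(* The map induced on quotients by a linear [f] with [f W] included in [W'];
   see [quot_mapE]. *)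
Definition quot_map (f : V -> V') (x : quot_space W) : quot_space W' :=
  \pi_(quot_space W') (f (repr x)).

Lemma quot_mapE (f : V -> V') : linear f -> {homo f : x / x \in W >-> x \in W'} ->
  forall x, quot_map f (\pi_(quot_space W) x) = \pi_(quot_space W') (f x).
Proof.
move=> lf fW x; apply/eqP; rewrite -quot_space_eq.
have -> : f (repr (\pi_(quot_space W) x)) - f x =
          f (repr (\pi_(quot_space W) x) - x).
  by rewrite addrC -scaleN1r -lf scaleN1r addrC.
by apply: fW; rewrite quot_space_eq reprK.
Qed.

End QuotientMaps.

Section Spans.
Context (R : pzRingType) (V : lmodType R) (A : V -> Prop).

Definition span_pred : {pred V} := fun x =>
  `[< exists s : seq (R * V),
        (forall p, p \in s -> A p.2) /\ x = \sum_(p <- s) p.1 *: p.2 >].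

Lemma span_closed : submod_closed span_pred.
Proof.
split=> [|a _ _ /asboolP[s [sA ->]] /asboolP[t [tA ->]]].
  by apply/asboolP; exists [::]; split=> //; rewrite big_nil.
apply/asboolP; exists ([seq (a * p.1, p.2) | p <- s] ++ t); split.
  by move=> p; rewrite mem_cat => /orP[/mapP[q qs ->]|/tA//]; apply: (sA q).
rewrite big_cat big_map scaler_sumr; congr (_ + _).
by apply: eq_bigr => p _; rewrite scalerA.
Qed.

Definition span : subspace V := Subspace span_closed.

Lemma mem_span x : A x -> x \in span.
Proof.
move=> Ax; apply/asboolP; exists [:: (1, x)]; split.
  by move=> p; rewrite inE => /eqP->.
by rewrite big_seq1 scale1r.
Qed.

End Spans.

Lemma span_homo (R : pzRingType) (V V' : lmodType R) (A : V -> Prop)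
    (W' : subspace V') (f : V -> V') :
  linear f -> (forall x, A x -> f x \in W') ->
  {homo f : x / x \in span A >-> x \in W'}.
Proof.
move=> lf fA _ /asboolP[s [sA ->]].
have f0 : f 0 = 0.
  by have := lf (-1) 0 0; rewrite !scaleN1r oppr0 addr0 addNr.
elim: s sA => [|p s IHs] sA; first by rewrite big_nil f0 rpred0.
rewrite big_cons lf rpredD// ?rpredZ//.
  by apply/fA/sA; rewrite mem_head.
by apply: IHs => q qs; apply: sA; rewrite inE qs orbT.
Qed.

Section FreeLift.
Context (R : nzRingType) (K : choiceType) (M : lmodType R) (f : K -> M).

HB.instance Definition _ :=
  GRing.isZmodMorphism.Build {freeg K / R} M (fglift f) (lift_is_additive f).

Lemma fglift_linear : linear (fglift f : {freeg K / R} -> M).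
Proof.
move=> a x y; rewrite raddfD /=; congr (_ + _).
rewrite -[X in fglift f X]/(fgscale a x) /fgscale raddf_sum /=.
rewrite -[in RHS](freeg_sumE x) raddf_sum scaler_sumr /=.
by apply: eq_bigr => z _; rewrite !liftU scalerA.
Qed.

HB.instance Definition _ :=
  GRing.isLinear.Build R {freeg K / R} M _ (fglift f) fglift_linear.

End FreeLift.

Section Groups.
Context (G : groupType).
Implicit Types (A H : {pred G}).
Local Open Scope group_scope.

Definition lcoset (g : G) H : {pred G} := fun x => g^-1 * x \in H.

Lemma mem_lcoset g H x : (x \in lcoset g H) = (g^-1 * x \in H).
Proof. by []. Qed.

Lemma mem_lcosetP g H x :
  reflect (exists2 h, h \in H & x = g * h) (x \in lcoset g H).
Proof.
rewrite mem_lcoset; apply: (iffP idP) => [gxH|[h hH ->]]; last by rewrite mulKg.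
by exists (g^-1 * x) => //; rewrite mulVKg.
Qed.

Lemma lcoset_trans (H : groupClosed G) a b c :
  b \in lcoset a H -> c \in lcoset a H -> c \in lcoset b H.
Proof.
rewrite !mem_lcoset => abH acH.
rewrite -[b^-1](mulgK a) -mulgA gpredM//.
by rewrite -gpredV invgM invgK.
Qed.

Definition generates A H : Prop :=
  {subset A <= H} /\
  forall K : groupClosed G, {subset A <= K} -> {subset H <= K}.

Definition finitely_generated H : Prop :=
  exists A : {fset G}, generates [in A] H.

End Groups.

Record group_pair (G : groupType) := GroupPair {
  gp_index : finType;
  gp_sub :> gp_index -> groupClosed G;
  gp_nonempty : (0 < #|gp_index|)%N }.

Record bounded_module (R : realType) (G : groupType) := BoundedModule {
  bm_space :> normedModType R;
  bm_act : G -> bm_space -> bm_space;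
  bm_act_linear : forall g, linear (bm_act g);
  bm_act1 : forall v, bm_act 1%g v = v;
  bm_actM : forall g h v, bm_act (g * h)%g v = bm_act g (bm_act h v);
  bm_bounded : exists2 L : R, 0 < L &
    forall g v, `|bm_act g v| <= L * `|v| }.

Section RelativeCohomology.
Context (R : realType) (G : groupType) (P : group_pair G).

Definition simplex k : Type := k.+1.-tuple (G * gp_index P).
HB.instance Definition _ k := Choice.on (simplex k).

Definition face k (j : 'I_k.+2) (s : simplex k.+1) : simplex k :=
  [tuple tnth s (fintype.lift j i) | i < k.+1].

Definition simplex_act k (g : G) (s : simplex k) : simplex k :=
  [tuple ((g * (tnth s i).1)%g, (tnth s i).2) | i < k.+1].

Definition St k := {freeg (simplex k) / R}.
HB.instance Definition _ k := GRing.Lmodule.on (St k).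

Definition basis k (s : simplex k) : St k := [freeg [:: (1, s)]].

Definition St_boundary k : St k.+1 -> St k :=
  fglift (fun s => \sum_(j < k.+2) (-1) ^+ j *: basis (face j s)).

Definition St_act k (g : G) : St k -> St k :=
  fglift (fun s => basis (simplex_act g s)).

Lemma St_boundary_linear k : linear (@St_boundary k).
Proof. exact: fglift_linear. Qed.

Lemma St_act_linear k g : linear (@St_act k g).
Proof. exact: fglift_linear. Qed.

Lemma St_boundary_basis k (s : simplex k.+1) :
  St_boundary (basis s) = \sum_(j < k.+2) (-1) ^+ j *: basis (face j s).
Proof. by rewrite /St_boundary liftU scale1r. Qed.

Lemma St_act_basis k g (s : simplex k) :
  St_act g (basis s) = basis (simplex_act g s).
Proof. by rewrite /St_act liftU scale1r. Qed.

Lemma St_ext k (M : lmodType R) (f f' : St k -> M) : linear f -> linear f' ->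
  (forall s, f (basis s) = f' (basis s)) -> f =1 f'.
Proof.
move=> lf lf' ff' x.
have f0 h : linear h -> h 0 = 0 :> M.
  by move=> /(_ (-1) 0 0); rewrite scaler0 addr0 scaleN1r addNr.
rewrite -[x]freeg_sumE; elim: (dom x) => [|z r IHr].
  by rewrite big_nil !f0.
rewrite big_cons; have -> : << coeff z x *g z >> = coeff z x *: basis z.
  by apply/eqP/freeg_eqP => y; rewrite coeffZ !coeffU mul1r.
by rewrite lf lf' ff' IHr.
Qed.

Lemma face_act k g (j : 'I_k.+2) (s : simplex k.+1) :
  face j (simplex_act g s) = simplex_act g (face j s).
Proof. by apply: eq_from_tnth => i; rewrite !tnth_mktuple. Qed.

Lemma St_boundary_act k g x :
  St_boundary (St_act g x) = St_act g (@St_boundary k x).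
Proof.
move: x; apply: St_ext => [a x y|a x y|s].
- by rewrite St_act_linear St_boundary_linear.
- by rewrite St_boundary_linear St_act_linear.
rewrite St_act_basis !St_boundary_basis [RHS]raddf_sum /=.
apply: eq_bigr => j _; rewrite linearZ /=; congr (_ *: _).
by rewrite face_act -St_act_basis.
Qed.

Definition peripheral_simplex k (s : simplex k) : Prop :=
  exists i, forall j : 'I_k.+1,
    (tnth s j).2 = i /\ (tnth s j).1 \in lcoset (tnth s ord0).1 (P i).

Definition St' k : subspace (St k) :=
  span (fun x => exists2 s : simplex k, peripheral_simplex s & x = basis s).

Definition St_rel k := quot_space (St' k).
HB.instance Definition _ k := GRing.Lmodule.on (St_rel k).

Definition rel_boundary k : St_rel k.+1 -> St_rel k :=
  quot_map (St' k) (@St_boundary k).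

Definition rel_act k (g : G) : St_rel k -> St_rel k :=
  quot_map (St' k) (@St_act k g).

Lemma St_boundary_St' k :
  {homo @St_boundary k : x / x \in St' k.+1 >-> x \in St' k}.
Proof.
apply: span_homo => [|_ [s [i si] ->]]; first exact: fglift_linear.
rewrite St_boundary_basis rpred_sum// => j _; rewrite rpredZ//.
apply: mem_span; exists (face j s) => //; exists i => l.
rewrite !tnth_mktuple; split; first exact: (si _).1.
have [_ +] := si (fintype.lift j l); have [_ +] := si (fintype.lift j ord0).
exact: lcoset_trans.
Qed.

Lemma St_act_St' k g : {homo @St_act k g : x / x \in St' k >-> x \in St' k}.
Proof.
apply: span_homo => [|_ [s [i si] ->]]; first exact: fglift_linear.
rewrite St_act_basis; apply: mem_span; exists (simplex_act g s) => //.
exists i => j; rewrite !tnth_mktuple/=; have [sj1 sj2] := si j; split=> //.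
by move: sj2; rewrite !mem_lcoset invgM -mulgA mulKg.
Qed.

Lemma rel_boundaryE k x :
  rel_boundary (\pi_(St_rel k.+1) x) = \pi_(St_rel k) (St_boundary x).
Proof. by apply: quot_mapE; [exact: fglift_linear|exact: St_boundary_St']. Qed.

Lemma rel_actE k g x :
  rel_act g (\pi_(St_rel k) x) = \pi_(St_rel k) (St_act g x).
Proof. by apply: quot_mapE; [exact: fglift_linear|exact: St_act_St']. Qed.

Lemma rel_boundary_linear k : linear (@rel_boundary k).
Proof.
move=> a x y; rewrite -[x]reprK -[y]reprK.
rewrite -pi_quot_linear !rel_boundaryE [X in \pi_(St_rel k) X]fglift_linear.
exact: pi_quot_linear.
Qed.

Lemma rel_boundary_act k g x :
  rel_boundary (rel_act g x) = rel_act g (@rel_boundary k x).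
Proof.
rewrite -[x]reprK rel_actE !rel_boundaryE rel_actE.
by rewrite St_boundary_act.
Qed.

Context (V : bounded_module R G).

Definition is_cochain k (f : St_rel k -> V) : Prop :=
  linear f /\ forall g x, f (rel_act g x) = bm_act g (f x).

Definition coboundary k (f : St_rel k -> V) : St_rel k.+1 -> V :=
  f \o @rel_boundary k.

Definition cocycle_pred k : {pred St_rel k -> V} := fun f =>
  `[< is_cochain f /\ coboundary f = 0 >].

Lemma coboundary_cochain k (f : St_rel k -> V) :
  is_cochain f -> is_cochain (coboundary f).
Proof.
move=> [lf ef]; have fE x : coboundary f x = f (rel_boundary x) by [].
split=> [a x y|g x]; last by rewrite fE (rel_boundary_act g x) ef.
by rewrite fE (rel_boundary_linear a x y) lf.
Qed.

Lemma is_cochainP k (a : R) (f f' : St_rel k -> V) :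
  is_cochain f -> is_cochain f' -> is_cochain (a *: f + f').
Proof.
move=> [lf ef] [lf' ef']; have fE x : (a *: f + f') x = a *: f x + f' x by [].
split=> [b x y|g x]; rewrite !fE; last by rewrite bm_act_linear ef ef'.
rewrite lf lf' !scalerDr !scalerA [b * a]mulrC -!addrA; congr (_ + _).
by rewrite addrCA.
Qed.

Lemma is_cochain0 k : is_cochain (0 : St_rel k -> V).
Proof.
have fE x : (0 : St_rel k -> V) x = 0 by [].
split=> [a x y|g x]; rewrite !fE; first by rewrite scaler0 addr0.
by have := bm_act_linear g (-1) 0 (0 : V); rewrite !scaleN1r oppr0 addr0 addNr.
Qed.

Lemma cocycle_closed k : submod_closed (@cocycle_pred k).
Proof.
split=> [|a f f' /asboolP[cf df] /asboolP[cf' df']].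
  by apply/asboolP; split; [exact: is_cochain0|].
apply/asboolP; split; first exact: is_cochainP.
rewrite -[LHS]/(a *: coboundary f + coboundary f') df df'.
by rewrite scaler0 addr0.
Qed.

Definition cocycles k : subspace (St_rel k -> V) := Subspace (@cocycle_closed k).

(* In degree 0 there are no nonzero coboundaries, since St_(-1) = 0. *)
Definition coboundary_pred k : {pred subspace_type (cocycles k)} :=
  match k with
  | 0 => fun z => z == 0
  | k'.+1 => fun z => `[< exists2 f, is_cochain f & val z = @coboundary k' f >]
  end.

Lemma coboundary_closed k : submod_closed (@coboundary_pred k).
Proof.
case: k => [|k].
  by split=> [|a x y /eqP-> /eqP->]; rewrite unfold_in /= ?scaler0 ?addr0.
split=> [|a x y /asboolP[f cf xf] /asboolP[f' cf' yf']]; apply/asboolP.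
  by exists 0; [exact: is_cochain0|].
exists (a *: f + f'); first exact: is_cochainP.
have -> : val (a *: x + y) = a *: val x + val y by [].
by rewrite xf yf'.
Qed.

Definition coboundaries k : subspace (subspace_type (cocycles k)) :=
  Subspace (@coboundary_closed k).

Definition rel_cohomology k := quot_space (coboundaries k).
HB.instance Definition _ k := GRing.Lmodule.on (rel_cohomology k).

End RelativeCohomology.

Section GraphMetric.
Context (T : Type) (e : rel T).

Definition walk (n : nat) (x y : T) : Prop :=
  exists p : seq T, [/\ path e x p, last x p = y & size p = n].

(* The length of a shortest walk, or 0 if no walk joins [x] to [y]. *)
Definition graph_dist (x y : T) : nat :=
  xget 0%N [set n | walk n x y /\ forall m, walk m x y -> (n <= m)%N]%classic.

End GraphMetric.

Section Hyperbolicity.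
Context (R : realType) (T : Type).

Definition gromov_product (d : T -> T -> R) (w x y : T) : R :=
  (d x w + d y w - d x y) / 2.

Definition gromov_hyperbolic (d : T -> T -> R) : Prop :=
  exists delta : R, forall w x y z,
    Num.min (gromov_product d w x y) (gromov_product d w y z) - delta
      <= gromov_product d w x z.

(* Gromov's definition, applied to the vertex set with the graph metric. *)
Definition hyperbolic_graph (e : rel T) : Prop :=
  (forall x y, exists n, walk e n x y) /\
  gromov_hyperbolic (fun x y => (graph_dist e x y)%:R).

End Hyperbolicity.

Section CuspedGraph.
Context (G : groupType) (P : group_pair G) (S : {fset G}).
Local Open Scope group_scope.

Definition word_dist (A : {pred G}) : G -> G -> nat :=
  graph_dist (fun g h => g^-1 * h \in A).

Definition compatible : Prop :=
  [/\ 1 \notin S, (forall s, s \in S -> s^-1 \in S), generates [in S] predT &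
      forall i, generates [pred s in S | s \in P i] (P i)].

(* Quotient of the set of triples (g, i, n) by the identification of all the
   (g, i, 0), in normal form: [Horo g i n] is the vertex (g, i, n.+1).
   [cvertex] is the quotient map. *)
Inductive cusped_vertex : Type :=
| Ground of G
| Horo of G & gp_index P & nat.

Definition cvertex (g : G) (i : gp_index P) (n : nat) : cusped_vertex :=
  if n is n'.+1 then Horo g i n' else Ground g.

Inductive cusped_edge : cusped_vertex -> cusped_vertex -> Prop :=
| GroundEdge g h i j of g^-1 * h \in S :
    cusped_edge (cvertex g i 0) (cvertex h j 0)
| UpEdge g i n : cusped_edge (cvertex g i n) (cvertex g i n.+1)
| DownEdge g i n : cusped_edge (cvertex g i n.+1) (cvertex g i n)
| HoroEdge g h i n of (0 < n)%N & g != h & lcoset g (P i) =i lcoset h (P i)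
    & (word_dist [pred s in S | s \in P i] 1 (g^-1 * h) <= 2 ^ n)%N :
    cusped_edge (cvertex g i n) (cvertex h i n).

Definition cusped_graph : rel cusped_vertex :=
  fun x y => `[< cusped_edge x y >].

End CuspedGraph.

Arguments cusped_graph {G} P S.

Definition relatively_hyperbolic (R : realType) (G : groupType)
    (P : group_pair G) : Prop :=
  [/\ finitely_generated (predT : {pred G}),
      (forall i, finitely_generated (P i)) &
      exists2 S : {fset G}, compatible P S &
        hyperbolic_graph R (cusped_graph P S)].

(* Main.v *)
Require Import Defs.
From HB Require Import structures.
From mathcomp Require Import all_boot all_order all_algebra.
From mathcomp Require Import finmap zify lra.
From mathcomp Require Import boolp classical_sets functions reals.
From mathcomp Require Import topology normedtype.
From mathcomp Require Import freeg.

Set Implicit Arguments.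
Unset Strict Implicit.
Unset Printing Implicit Defensive.

Import Order.TTheory GRing.Theory Num.Theory.

Local Open Scope ring_scope.

(* The cusped graph X is hyperbolic, so for D large the complex of tuples of
   vertices of X with pairwise distances at most D is acyclic; so is its
   subcomplex of tuples in a fixed horoball (contract towards the point at
   infinity of the horoball).  As Gamma acts freely on the basis of St, these
   two facts give an equivariant chain map from St to that complex which sends
   St' into the horoballs.  Compose it with the map forgetting the depth
   coordinate, X -> Gamma * I, and with antisymmetrization.  The result is an
   equivariant chain map from St to St, preserving St' and homotopic to the
   identity by coning off at the first entry of a tuple.  A tuple of diameter
   at most D that is not contained in one horoball lies in a ball of bounded
   cardinality, so that in high degree it has a repeated entry and is killed by
   antisymmetrization.  Hence the induced map on St / St' vanishes in high
   degree, although it is homotopic to the identity. *)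

(** * Augmented complexes of tuples *)

Lemma span_ext (R : nzRingType) (V M : lmodType R) (f f' : {linear V -> M})
    (A : V -> Prop) :
  (forall x, A x -> f x = f' x) -> {in Defs.span A, f =1 f'}.
Proof.
move=> ff' _ /asboolP[l [lA ->]]; rewrite !linear_sum.
rewrite big_seq [RHS]big_seq; apply: eq_bigr => p /lA Ap.
by rewrite !linearZ /= ff'.
Qed.

Section Chains.
Context (R : nzRingType) (T : choiceType).

(** Tuples of all lengths share one module, so that operators are plain endomorphisms; degrees and
    supports are recorded by spans of tuples. *)
Definition chain : Type := {freeg (seq T) / R}.
HB.instance Definition _ := GRing.Lmodule.on chain.

Definition tuple_chain (s : seq T) : chain := [freeg [:: (1, s)]].

Definition chain_span (Q : seq T -> Prop) : Defs.subspace chain :=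
  Defs.span (fun c => exists2 s, Q s & c = tuple_chain s).

Lemma mem_chain_span (Q : seq T -> Prop) s :
  Q s -> tuple_chain s \in chain_span Q.
Proof. by move=> Qs; apply: mem_span; exists s. Qed.

Lemma chain_spanT c : c \in chain_span (fun=> True).
Proof.
rewrite -[c]freeg_sumE rpred_sum// => s _.
have -> : << coeff s c *g s >> = coeff s c *: tuple_chain s.
  by apply/eqP/freeg_eqP => y; rewrite coeffZ !coeffU mul1r.
by rewrite rpredZ// mem_chain_span.
Qed.

(** A chain has finite support. This reduces fillings to finitely many vertices, where a total rank
    or a maximal height exists. *)
Lemma chain_span_fin (Q : seq T -> Prop) c : c \in chain_span Q ->
  exists2 F : seq T, (forall v, v \in F -> exists2 s, Q s & v \in s) &
    c \in chain_span (fun s => Q s /\ {subset s <= F}).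
Proof.
move=> /asboolP[l [lQ ->{c}]]; elim: l lQ => [|p l IHl] lQ.
  by exists [::]; rewrite ?big_nil ?rpred0.
have [|F FQ lF] := IHl; first by move=> q ql; apply: lQ; rewrite inE ql orbT.
have [s Qs ps] := lQ _ (mem_head p l).
exists (s ++ F); first by move=> v; rewrite mem_cat => /orP[|/FQ//]; exists s.
rewrite big_cons rpredD//.
  rewrite ps rpredZ// mem_chain_span//; split=> // x xs.
  by rewrite mem_cat xs.
move: lF; apply: span_homo (fun c => c) _ _ _ => // _ [t [Qt tF] ->].
by apply: mem_chain_span; split=> // x /tF xF; rewrite mem_cat xF orbT.
Qed.

End Chains.

Arguments tuple_chain {R T}.
Arguments chain_span R {T} Q : simpl never.

Section LinearMaps.
Context (R : nzRingType) (T : choiceType).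

Lemma chain_span_homo (M : lmodType R) (f : {linear chain R T -> M})
    (Q : seq T -> Prop) (W : Defs.subspace M) :
  (forall s, Q s -> f (tuple_chain s) \in W) ->
  forall c, c \in chain_span R Q -> f c \in W.
Proof.
by move=> fQ; apply: span_homo => [|_ [s Qs ->]]; [exact: linearP|exact: fQ].
Qed.

Lemma chain_span_sub (Q Q' : seq T -> Prop) :
  (forall s, Q s -> Q' s) -> {subset chain_span R Q <= chain_span R Q'}.
Proof.
move=> QQ' c; apply: (chain_span_homo (f := idfun)) => s /QQ'.
exact: mem_chain_span.
Qed.

Lemma chain_span_ext (M : lmodType R) (f f' : {linear chain R T -> M})
    (Q : seq T -> Prop) :
  (forall s, Q s -> f (tuple_chain s) = f' (tuple_chain s)) ->
  {in chain_span R Q, f =1 f'}.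
Proof. by move=> ff'; apply: span_ext => _ [s /ff' ? ->]. Qed.

Lemma chain_ext (M : lmodType R) (f f' : {linear chain R T -> M}) :
  (forall s, f (tuple_chain s) = f' (tuple_chain s)) -> f =1 f'.
Proof.
by move=> ? c; apply: (chain_span_ext (Q := fun=> True)); rewrite ?chain_spanT.
Qed.

Definition clift (M : lmodType R) (f : seq T -> M) : chain R T -> M := fglift f.
HB.instance Definition _ (M : lmodType R) (f : seq T -> M) :=
  GRing.isLinear.Build R (chain R T) M _ (clift f) (fglift_linear f).

Lemma cliftE (M : lmodType R) (f : seq T -> M) s :
  clift f (tuple_chain s) = f s.
Proof. by rewrite [LHS]liftU scale1r. Qed.

Definition cone (x : T) : chain R T -> chain R T :=
  clift (fun s => tuple_chain (x :: s)).
HB.instance Definition _ x := GRing.Linear.on (cone x).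

Lemma coneE x s : cone x (tuple_chain s) = tuple_chain (x :: s).
Proof. exact: cliftE. Qed.

(* The augmented complex: a tuple [x :: s] has degree [size s], and the empty
   tuple spans degree -1. *)
Fixpoint bd_tuple (s : seq T) : chain R T :=
  if s is x :: s' then tuple_chain s' - cone x (bd_tuple s') else 0.

Definition bd : chain R T -> chain R T := clift bd_tuple.
HB.instance Definition _ := GRing.Linear.on bd.

Lemma bd_cons x s :
  bd (tuple_chain (x :: s)) = tuple_chain s - cone x (bd (tuple_chain s)).
Proof. by rewrite /bd !cliftE. Qed.

Lemma bd_nil : bd (tuple_chain [::]) = 0.
Proof. by rewrite /bd cliftE. Qed.

(** Coning at [x] contracts the augmented complex; in particular [cone x c] fills a cycle [c]. *)
Lemma bd_cone x c : bd (cone x c) = c - cone x (bd c).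
Proof.
move: c; apply: (chain_ext (f := bd \o cone x) (f' := idfun \- (cone x \o bd))).
by move=> s; rewrite /= coneE bd_cons.
Qed.

Lemma bd_bd c : bd (bd c) = 0.
Proof.
move: c; apply: (chain_ext (f := bd \o bd) (f' := \0)).
elim=> [|x s IHs] /=; first by rewrite bd_nil linear0.
by rewrite bd_cons linearB /= bd_cone (IHs : bd (bd _) = 0) linear0 subr0 subrr.
Qed.

Lemma bd_in s : bd (tuple_chain s) \in
  chain_span R (fun t => (size t).+1 = size s /\ {subset t <= s}).
Proof.
elim: s => [|x s IHs]; first by rewrite bd_nil rpred0.
rewrite bd_cons rpredB//.
  by apply: mem_chain_span; split=> // y ys; rewrite inE ys orbT.
move: IHs; apply: chain_span_homo => t [ts tS] /=.
rewrite coneE; apply: mem_chain_span; split; first by rewrite /= ts.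
by move=> y; rewrite !inE => /orP[->//|/tS->]; rewrite orbT.
Qed.

End LinearMaps.

Section ChainMaps.
Context (R : nzRingType).

Definition cmap (T T' : choiceType) (f : T -> T') : chain R T -> chain R T' :=
  clift (fun s => tuple_chain (map f s)).
HB.instance Definition _ (T T' : choiceType) (f : T -> T') :=
  GRing.Linear.on (cmap f).

Lemma cmapE (T T' : choiceType) (f : T -> T') s :
  cmap f (tuple_chain s) = tuple_chain (map f s).
Proof. exact: cliftE. Qed.

Lemma cmap_comp (T1 T2 T3 : choiceType) (f : T1 -> T2) (g : T2 -> T3) c :
  cmap (g \o f) c = cmap g (cmap f c).
Proof.
move: c; apply: (chain_ext (f := cmap (g \o f)) (f' := cmap g \o cmap f)) => s.
by rewrite /= !cmapE map_comp.
Qed.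

Lemma eq_cmap (T T' : choiceType) (f g : T -> T') : f =1 g -> cmap f =1 cmap g.
Proof. by move=> fg; apply: chain_ext => s; rewrite /= !cmapE (eq_map fg). Qed.

Lemma cmap_id (T : choiceType) c : cmap (@id T) c = c.
Proof.
move: c; apply: (chain_ext (f := cmap id) (f' := idfun)) => s.
by rewrite /= cmapE map_id.
Qed.

Lemma cmap_cone (T T' : choiceType) (f : T -> T') x c :
  cmap f (cone x c) = cone (f x) (cmap f c).
Proof.
move: c; apply: (chain_ext (f := cmap f \o cone x)
  (f' := cone (f x) \o cmap f)) => s.
by rewrite /= !coneE !cmapE coneE.
Qed.

Lemma cmap_bd (T T' : choiceType) (f : T -> T') c :
  cmap f (bd c) = bd (cmap f c).
Proof.
move: c; apply: (chain_ext (f := cmap f \o @bd R T) (f' := @bd R T' \o cmap f)).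
elim=> [|x s IHs] /=; first by rewrite cmapE /= !bd_nil linear0.
rewrite bd_cons linearB /= cmap_cone (IHs : cmap f (bd _) = bd (cmap f _)).
by rewrite !cmapE /= bd_cons.
Qed.

End ChainMaps.

(** * The prism homotopy of a vertex map *)

Section Prism.
Context (R : nzRingType) (T : choiceType) (f : T -> T).

(** This is the classical sum of the tuples $(x_0,\dots,x_j,f x_j,\dots,f x_k)$ with signs $(-1)^j$,
    unfolded along the first entry. *)
Fixpoint prism_tuple (s : seq T) : chain R T :=
  if s is x :: s' then
    tuple_chain (x :: map f (x :: s')) - cone x (prism_tuple s')
  else 0.

Definition prism : chain R T -> chain R T := clift prism_tuple.
HB.instance Definition _ := GRing.Linear.on prism.

Lemma prism_cons x s : prism (tuple_chain (x :: s)) =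
  cone x (cone (f x) (cmap f (tuple_chain s))) - cone x (prism (tuple_chain s)).
Proof. by rewrite /prism !cliftE /= cmapE !coneE. Qed.

Lemma prism_cone x c :
  prism (cone x c) = cone x (cone (f x) (cmap f c)) - cone x (prism c).
Proof.
move: c; apply: (chain_ext (f := prism \o cone x)
  (f' := (cone x \o (cone (f x) \o cmap f)) \- (cone x \o prism))) => s.
by rewrite /= coneE prism_cons.
Qed.

Lemma bd_prism c : bd (prism c) + prism (bd c) = cmap f c - c.
Proof.
move: c; apply: (chain_ext (f := (@bd R T \o prism) \+ (prism \o @bd R T))
  (f' := cmap f \- idfun)).
elim=> [|x s IHs] /=.
  by rewrite cmapE bd_nil /prism cliftE !linear0 addr0 subrr.
have {}IHs : bd (prism (tuple_chain s)) + prism (bd (tuple_chain s)) =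
    cmap f (tuple_chain s) - tuple_chain s by exact: IHs.
have {}IHs : prism (bd (tuple_chain s)) =
    cmap f (tuple_chain s) - tuple_chain s - bd (prism (tuple_chain s)).
  by rewrite -IHs addrC addKr.
rewrite prism_cons bd_cons !linearB /= !bd_cone prism_cone -cmap_bd.
rewrite -coneE cmap_cone !(linearB (cone _)) /= IHs !linearB /=.
set A := cone (f x) _; set B := cone x (cmap f _); set E := cone x (cone _ _).
set p := prism _; set q := cone x (bd p); set r := cone x _.
rewrite !opprK -addrA [- p + q]addrC [q - p + _]addrA subrK.
rewrite [q + _]addrCA [q + _]addrC subrK [- E + _]addrA [- E + B]addrC.
by rewrite [- B + E]addrC -[E - B]opprB -[A - _ + _]addrA addKr.
Qed.

Lemma prism_in s : prism (tuple_chain s) \in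
  chain_span R (fun t => size t = (size s).+1 /\ {subset t <= s ++ map f s}).
Proof.
elim: s => [|x s IHs]; first by rewrite /prism cliftE rpred0.
rewrite prism_cons rpredB//.
  rewrite cmapE !coneE; apply: mem_chain_span; split.
    by rewrite /= size_map.
  by move=> y; rewrite !(inE, mem_cat) => /or3P[->|->|->]; rewrite ?orbT.
move: IHs; apply: chain_span_homo => t [ts tS]; rewrite /= coneE.
apply: mem_chain_span; split; first by rewrite /= ts.
move=> y; rewrite !(inE, mem_cat) => /orP[->//|/tS].
by rewrite mem_cat => /orP[->|->]; rewrite ?orbT.
Qed.

End Prism.

(** * Recursive construction of chain maps, degree by degree *)

Section TupleRecursion.
Context (R : nzRingType) (T : choiceType).

(** The induction is on the length: the faces of [x :: s] are various tuples of the length of [s],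
    not only [s] itself. *)
Lemma tuple_ind (A : seq T -> Prop) : A [::] ->
  (forall x s, (forall t, size t = size s -> A t) -> A (x :: s)) ->
  forall s, A s.
Proof.
move=> A0 A1 s; move: {2}(size s) (erefl (size s)) => n.
by elim: n s => [|n IHn] [|x s] // [sn]; apply: A1 => t; rewrite sn; apply: IHn.
Qed.

Lemma bd_cons_in (x : T) s : bd (tuple_chain (x :: s)) \in
  chain_span R (fun t => size t = size s /\ {subset t <= x :: s}).
Proof. by apply: chain_span_sub (bd_in R (x :: s)) => t [[->]]. Qed.

Context (M : lmodType R) (c0 : M) (F : T -> seq T -> M -> M).

(** [F] receives the value already built on the boundary of the tuple. Faces are not structural
    subterms, so [n] serves as fuel; [crec] starts with the length of the tuple, and then the value
    0 for exhausted fuel is not reached. *)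
Fixpoint rec_tuple n (s : seq T) : M :=
  if s isn't x :: s' then c0 else
  if n is n'.+1 then F x s' (clift (rec_tuple n') (bd (tuple_chain s))) else 0.

Definition crec : chain R T -> M := clift (fun s => rec_tuple (size s) s).
HB.instance Definition _ := GRing.Linear.on crec.

Lemma crec_nil : crec (tuple_chain [::]) = c0.
Proof. by rewrite /crec cliftE. Qed.

Lemma crec_cons x s :
  crec (tuple_chain (x :: s)) = F x s (crec (bd (tuple_chain (x :: s)))).
Proof.
rewrite {1}/crec cliftE /=; congr (F x s _).
apply: chain_span_ext (bd_cons_in x s) => t [ts _].
by rewrite /= cliftE /crec cliftE ts.
Qed.

End TupleRecursion.

Section RecursionTheory.
Context (R : nzRingType).

(** [cmap f] commutes with [bd], so compatibility of the step [F] propagates through all degrees.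
    With [f] a translation this yields equivariance. *)
Lemma crec_natural (T T' : choiceType) (M M' : lmodType R)
    (c0 : M) (F : T -> seq T -> M -> M)
    (c0' : M') (F' : T' -> seq T' -> M' -> M')
    (f : T -> T') (p : {linear M -> M'}) :
  p c0 = c0' -> (forall x s c, p (F x s c) = F' (f x) (map f s) (p c)) ->
  forall c, p (crec c0 F c) = crec c0' F' (cmap f c).
Proof.
move=> p0 pF; apply: (chain_ext (f := p \o crec c0 F)
  (f' := crec c0' F' \o cmap f)).
elim/tuple_ind => [|x s IHs] /=; first by rewrite cmapE !crec_nil.
rewrite cmapE /= !crec_cons pF; congr F'.
rewrite -[f x :: _]/(map f (x :: s)) -cmapE -cmap_bd.
apply: (chain_span_ext (f := p \o crec c0 F) (f' := crec c0' F' \o cmap f))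
  (bd_cons_in R x s) => t [ts _].
exact: IHs.
Qed.

(** The method of acyclic carriers. The carrier [Q] grows with the tuple, so the values on all faces
    of [x :: s] lie in the carrier of [x :: s], where [F] fills cycles. *)
Lemma crec_carried (T T' : choiceType) (c0 : chain R T')
    (F : T -> seq T -> chain R T' -> chain R T')
    (Q : nat -> seq T -> seq T' -> Prop) :
  (forall n s t u, {subset t <= s} -> Q n t u -> Q n s u) ->
  c0 \in chain_span R (Q 0%N [::]) -> bd c0 = 0 ->
  (forall x s c, c \in chain_span R (Q (size s) (x :: s)) -> bd c = 0 ->
    F x s c \in chain_span R (Q (size s).+1 (x :: s)) /\ bd (F x s c) = c) ->
  forall s, crec c0 F (tuple_chain s) \in chain_span R (Q (size s) s) /\
    bd (crec c0 F (tuple_chain s)) = crec c0 F (bd (tuple_chain s)).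
Proof.
move=> Qs Q0 bd0 QF; elim/tuple_ind => [|x s IHs].
  by rewrite crec_nil bd_nil linear0.
have cQ : crec c0 F (bd (tuple_chain (x :: s))) \in
    chain_span R (Q (size s) (x :: s)).
  apply: chain_span_homo (bd_cons_in R x s) => t [ts tS] /=.
  have [+ _] := IHs t ts; rewrite ts; apply: chain_span_sub => u.
  exact: Qs.
have bdc : bd (crec c0 F (bd (tuple_chain (x :: s)))) = 0.
  rewrite -[RHS](linear0 (crec c0 F)) -(bd_bd (tuple_chain (x :: s))).
  apply: (chain_span_ext (f := @bd R T' \o crec c0 F)
    (f' := crec c0 F \o @bd R T)) (bd_cons_in R x s) => t [ts _].
  exact: (IHs t ts).2.
by have [] := QF x s _ cQ bdc; rewrite -crec_cons.
Qed.

End RecursionTheory.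

(** * Antisymmetrization *)

Section Alternation.
Context (R : numFieldType).

Definition mean_cone (T : choiceType) (x : T) (s : seq T) (c : chain R T) :=
  (size (x :: s))%:R^-1 *: \sum_(y <- x :: s) cone y c.

(* Antisymmetrization: the mean over all permutations of a tuple, with signs,
   in a form that makes it visibly a chain map. *)
Definition alternate (T : choiceType) : chain R T -> chain R T :=
  crec (tuple_chain [::]) (@mean_cone T).
HB.instance Definition _ (T : choiceType) := GRing.Linear.on (@alternate T).

Lemma alternateE (T : choiceType) (s : seq T) : s != [::] ->
  alternate (tuple_chain s) =
    (size s)%:R^-1 *: \sum_(y <- s) cone y (alternate (bd (tuple_chain s))).
Proof. by case: s => // x s _; rewrite [LHS]crec_cons. Qed.

Lemma alternate_nil (T : choiceType) :
  alternate (tuple_chain [::]) = tuple_chain [::] :> chain R T.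
Proof. exact: crec_nil. Qed.

Lemma alternate_natural (T T' : choiceType) (f : T -> T') c :
  cmap f (alternate c) = alternate (cmap f c).
Proof.
apply: crec_natural => [|x s {}c]; first by rewrite /= cmapE.
rewrite /= /mean_cone /= size_map linearZ linear_sum /=; congr (_ *: _).
rewrite !big_cons big_map cmap_cone; congr (_ + _).
by apply: eq_bigr => y _; rewrite cmap_cone.
Qed.

(** Each cone over a cycle fills that cycle, hence so does the mean of such cones. *)
Lemma alternate_carried (T : choiceType) (s : seq T) :
  alternate (tuple_chain s) \in
    chain_span R (fun t => size t = size s /\ {subset t <= s}) /\
  bd (alternate (tuple_chain s)) = alternate (bd (tuple_chain s)).
Proof.
move: s.
apply: (crec_carried (Q := fun n s t => size t = n /\ {subset t <= s})).
- by move=> n s t u ts [-> ut]; split=> // x /ut/ts.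
- by apply: mem_chain_span.
- exact: bd_nil.
move=> x s c cs bdc; split.
  rewrite /mean_cone rpredZ// big_seq rpred_sum// => y ys.
  move: cs; apply: chain_span_homo => t [ts tS] /=; rewrite coneE.
  apply: mem_chain_span; split; first by rewrite /= ts.
  by move=> z; rewrite inE => /orP[/eqP->//|/tS].
rewrite /mean_cone linearZ linear_sum /= (eq_bigr (fun=> c)) => [|y _].
  rewrite big_const_seq count_predT iter_addr_0 -scaler_nat scalerA.
  by rewrite mulVf ?scale1r// pnatr_eq0.
by rewrite bd_cone bdc linear0 subr0.
Qed.

Lemma alternate_bd (T : choiceType) (c : chain R T) :
  bd (alternate c) = alternate (bd c).
Proof.
move: c; apply: (chain_ext (f := @bd R T \o @alternate T)
  (f' := @alternate T \o @bd R T)) => s.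
exact: (alternate_carried s).2.
Qed.

Definition swap_span (T : choiceType) (n : nat) : Defs.subspace (chain R T) :=
  Defs.span (fun c => exists p x y q, size (p ++ x :: y :: q) = n /\
    c = tuple_chain (p ++ x :: y :: q) + tuple_chain (p ++ y :: x :: q)).

Arguments swap_span : simpl never.

Lemma mem_swap_span (T : choiceType) p x y q :
  tuple_chain (p ++ x :: y :: q) + tuple_chain (p ++ y :: x :: q) \in
    @swap_span T (size (p ++ x :: y :: q)).
Proof. by apply: mem_span; exists p, x, y, q. Qed.

Lemma cone_swap_span (T : choiceType) z n c :
  c \in swap_span T n -> cone z c \in swap_span T n.+1.
Proof.
apply: span_homo => [|_ [p [x [y [q [<- ->]]]]]]; first exact: linearP.
by rewrite linearD /= !coneE; apply: (mem_swap_span (z :: p)).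
Qed.

(** The defining relations of alternating chains form a subcomplex. *)
Lemma bd_swap_span (T : choiceType) (n : nat) c :
  c \in swap_span T n.+1 -> bd c \in swap_span T n.
Proof.
apply: span_homo => [|_ [p [x [y [q [+ ->]]]]]]; first exact: linearP.
elim: p n => [|z p IHp] n [sn].
  (* The faces that omit [x] or [y] cancel between the two orders. *)
  have -> : @bd R T (tuple_chain ([::] ++ x :: y :: q) +
      tuple_chain ([::] ++ y :: x :: q)) =
      ((@cone R T x \o cone y) \+ (cone y \o cone x)) (bd (tuple_chain q)).
    rewrite linearD /= !bd_cons !linearB /= !coneE ?opprB ?opprK.
    rewrite addrACA [X in _ + X]addrACA -opprD.
    by rewrite [tuple_chain (x :: q) + _]addrC addNKr.
  apply: chain_span_homo (bd_in R q) => t [ts _].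
  rewrite -sn -ts -[_ (tuple_chain t)]/(cone x (cone y (tuple_chain t)) +
    cone y (cone x (tuple_chain t))) !coneE.
  exact: (mem_swap_span [::] x y t).
set u := p ++ _ in sn IHp *; set v := p ++ _ in IHp *.
have -> : @bd R T (tuple_chain (z :: u) + tuple_chain (z :: v)) =
    (tuple_chain u + tuple_chain v) -
    cone z (bd (tuple_chain u + tuple_chain v)).
  by rewrite !linearD /= !bd_cons addrACA -opprD.
rewrite rpredB//; first by rewrite -sn; exact: mem_swap_span.
case: n sn => [|n] sn; first by move: sn; rewrite size_cat addnS.
by apply: cone_swap_span; apply: IHp.
Qed.

(** Induction on the length: two tuples that differ by a swap have the same entries to cone at, so
    their values add up to cones over [alternate] of an element of [swap_span] one length lower. *)
Lemma alternate_swap_span (T : choiceType) (n : nat) c :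
  c \in swap_span T n -> alternate c = 0.
Proof.
elim: n c => [|n IHn]; apply: (span_ext (f := @alternate T) (f' := \0)).
  by move=> c0 [p [x [y [q []]]]]; rewrite size_cat addnS.
move=> _ [p [x [y [q [sn ->]]]]] /=.
have pq : perm_eq (p ++ x :: y :: q) (p ++ y :: x :: q).
  by rewrite perm_cat2l; exact: (permEl (perm_catCA [:: x] [:: y] q)).
have ne u v : p ++ u :: v :: q != [::] by case: (p).
rewrite linearD /= !alternateE// -(perm_size pq) (perm_big _ pq) /=.
rewrite -scalerDr -big_split /= big1 ?scaler0// => z _.
rewrite -!linearD /= IHn ?linear0//.
apply: bd_swap_span; rewrite -sn; exact: mem_swap_span.
Qed.

Lemma alternate_swap (T : choiceType) p (x y : T) q :
  alternate (tuple_chain (p ++ y :: x :: q)) =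
  - alternate (tuple_chain (p ++ x :: y :: q)).
Proof.
apply/eqP; rewrite -addr_eq0 addrC -linearD /=.
by rewrite (alternate_swap_span (mem_swap_span _ _ _ _)).
Qed.

(** Swaps of neighbours move one occurrence next to another; swapping these two shows that the value
    is its own negative, and 2 is invertible. *)
Lemma alternate_repetition (T : choiceType) (s : seq T) :
  ~~ uniq s -> alternate (tuple_chain s) = 0.
Proof.
have rep q : forall p (x : T) r,
    alternate (tuple_chain (p ++ x :: q ++ x :: r)) = 0.
  elim: q => [|y q IHq] p x r.
    have /eqP := alternate_swap p x x r.
    rewrite -subr_eq0 opprK -mulr2n -scaler_nat scaler_eq0 pnatr_eq0 /=.
    by move/eqP.
  by rewrite alternate_swap -cat_rcons IHq oppr0.
suff: ~~ uniq s -> exists p x q r, s = p ++ x :: q ++ x :: r.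
  by move=> sP /sP[p [x [q [r ->]]]].
elim: s => //= x s IHs; rewrite negb_and negbK => /orP[|/IHs].
  by case/splitPr => q r; exists [::], x, q, r.
by case=> p [y [q [r ->]]]; exists (x :: p), y, q, r.
Qed.

End Alternation.

(** * Filling cycles in clique complexes *)

Section CliqueComplex.
Context (R : nzRingType) (T : choiceType).

(** The case $x=y$ is included, so [r v v] singles out the admissible vertices; this lets a relation
    restrict the complex to a horoball. *)
Definition clique (r : T -> T -> Prop) (n : nat) (s : seq T) : Prop :=
  size s = n /\ {in s &, forall x y, r x y}.

Lemma max_rank (rank : T -> nat) (F : seq T) : F != [::] ->
  exists2 v, v \in F & forall u, u \in F -> (rank u <= rank v)%N.
Proof.
elim: F => // x [|y F] IHF _.
  by exists x; rewrite ?inE// => u; rewrite inE => /eqP->.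
have [//|v vF vmax] := IHF; have [vx|xv] := leqP (rank v) (rank x).
  exists x; rewrite ?mem_head// => u; rewrite inE => /orP[/eqP->//|/vmax uv].
  exact: leq_trans uv vx.
exists v; first by rewrite inE vF orbT.
by move=> u; rewrite inE => /orP[/eqP->|/vmax//]; exact: ltnW.
Qed.

(* Rips' contraction: replacing a vertex [v] of maximal rank by the [v'] given
   by [move_down] is a homotopy, because every neighbour of [v] of no larger
   rank is a neighbour of [v'].  Repeating this makes all vertices neighbours
   of [w]. *)
Lemma clique_fill (r : T -> T -> Prop) (rank : T -> nat) (w : T) (rank0 : nat) :
  (forall x y, r x y -> r y x) -> r w w ->
  (forall v, r v v -> (rank v <= rank0)%N -> r v w) ->
  (forall v, r v v -> (rank0 < rank v)%N -> exists v',
    [/\ (rank v' < rank v)%N, r v' v' &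
        forall u, r u v -> (rank u <= rank v)%N -> r u v']) ->
  forall n c, c \in chain_span R (clique r n) -> bd c = 0 ->
    exists2 y, y \in chain_span R (clique r n.+1) & bd y = c.
Proof.
move=> rC rw cone_base move_down n c /chain_span_fin[F FQ].
have {FQ}rF v : v \in F -> r v v by move=> /FQ[s [_ rs] vs]; exact: rs.
(* Induction on the total rank of the finite vertex set [F] carrying [c]. *)
have [m] := ubnP (\sum_(u <- F) rank u)%N.
elim: m F rF c => // m IHm F rF c Fm cF bdc.
have [Flow|] := boolP (all (fun v => rank v <= rank0)%N F).
  exists (cone w c); last by rewrite bd_cone bdc linear0 subr0.
  move: cF; apply: chain_span_homo => s [[sn rs] sF].
  rewrite /= coneE; apply: mem_chain_span; split; first by rewrite /= sn.
  have sw x : x \in s -> r x w.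
    by move=> xs; apply: cone_base; [exact: rs|exact: (allP Flow _ (sF _ xs))].
  move=> x y; rewrite !inE => /orP[/eqP->|xs] /orP[/eqP->|ys] //.
  - exact/rC/sw.
  - exact: sw.
  - exact: rs.
move=> /allPn[v0 v0F]; rewrite -ltnNge => v0high.
have [|v vF vmax] := @max_rank rank F; first by apply: contraTneq v0F => ->.
have vhigh : (rank0 < rank v)%N := leq_trans v0high (vmax _ v0F).
have [v' [v'v rv' vv']] := move_down v (rF v vF) vhigh.
pose f x := if x == v then v' else x.
(* Since [v] has maximal rank in [F], the rank condition in [move_down] holds for every vertex of
   [F]. *)
have rf x y : x \in F -> r x y -> r x (f y).
  by rewrite /f; case: eqP => // -> xF xv; apply: vv' => //; exact: vmax.
have rff x y : x \in F -> y \in F -> r x y -> r (f x) (f y).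
  move=> xF yF rxy; have := rf _ _ xF rxy; rewrite {2}/f; case: eqP => // xv.
  move=> _; rewrite /f; case: eqP => [//|_]; subst x.
  by apply/rC; apply: vv'; [exact: rC|exact: vmax].
have [||||y yn bdy] := IHm (map f F) _ (cmap f c).
- move=> _ /mapP[x xF ->]; apply: rff => //; exact: rF.
- rewrite ltnS in Fm; apply: (leq_trans _ Fm); rewrite big_map.
  rewrite !(big_rem _ vF) /= /f eqxx -addSn leq_add//.
  by apply: leq_sum => x _; case: eqP => [->|//]; exact: ltnW.
- move: cF; apply: chain_span_homo => s [[sn rs] sF] /=; rewrite cmapE.
  apply: mem_chain_span; split; last first.
    by move=> _ /mapP[x /sF xF ->]; rewrite map_f.
  split; first by rewrite size_map.
  by move=> _ _ /mapP[x xs ->] /mapP[z zs ->]; apply: rff; auto; exact: rs.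
- by rewrite -cmap_bd bdc linear0.
(* [y] fills [cmap f c], and [prism f c] has boundary [cmap f c - c]. *)
exists (y - prism f c); last first.
  rewrite linearB /= bdy; have := bd_prism f c.
  by rewrite bdc linear0 addr0 => ->; rewrite subKr.
rewrite rpredB//; move: cF; apply: chain_span_homo => s [[sn rs] sF] /=.
apply: chain_span_sub (prism_in R f s) => t [tn tS]; split.
  by rewrite tn sn.
move=> x z /tS + /tS; rewrite !mem_cat.
move=> /orP[xs|/mapP[{}x xs ->]] /orP[zs|/mapP[{}z zs ->]].
- exact: rs.
- by apply: rf; [exact: sF|exact: rs].
- by apply/rC/rf; [exact: sF|exact: rs].
- by apply: rff; [exact: sF|exact: sF|exact: rs].
Qed.

End CliqueComplex.

(** * Graph metrics and the cusped graph *)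

Section GraphDistance.
Context (T : Type) (e : rel T).

Lemma walk0 x : walk e 0 x x.
Proof. by exists [::]. Qed.

Lemma walk0_eq x y : walk e 0 x y -> x = y.
Proof. by move=> [[|z p] []]. Qed.

Lemma walk1 x y : e x y -> walk e 1 x y.
Proof. by move=> xy; exists [:: y]; rewrite /= xy. Qed.

Lemma walkSP n x y : walk e n.+1 x y <-> exists2 z, e x z & walk e n z y.
Proof.
split=> [[[|z p] []]|[z xz [p [pz py pn]]]] //.
  move=> /= /andP[xz pz] py [pn].
  by exists z => //; exists p.
by exists (z :: p); rewrite /= xz pz pn.
Qed.

Lemma walk_cat m n x y z :
  walk e m x y -> walk e n y z -> walk e (m + n) x z.
Proof.
elim: m x => [|m IHm] x; first by move=> /walk0_eq->.
move=> /walkSP[x' xx' x'y] yz; rewrite addSn; apply/walkSP; exists x' => //.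
exact: IHm.
Qed.

Lemma walk_split m n x z :
  walk e (m + n) x z -> exists2 y, walk e m x y & walk e n y z.
Proof.
elim: m x => [|m IHm] x; first by exists x => //; exact: walk0.
rewrite addSn => /walkSP[x' xx' /IHm[y x'y yz]]; exists y => //.
by apply/walkSP; exists x'.
Qed.

Lemma walk_rev n x y : symmetric e -> walk e n x y -> walk e n y x.
Proof.
move=> eC; elim: n x => [|n IHn] x.
  by move=> /walk0_eq->; exact: walk0.
move=> /walkSP[z xz /IHn yz]; rewrite -addn1.
by apply: walk_cat yz (walk1 _); rewrite eC.
Qed.

Lemma dist_le n x y : walk e n x y -> (graph_dist e x y <= n)%N.
Proof.
by rewrite /graph_dist; case: xgetP => //= m _ [_ mmin] /mmin.
Qed.

Lemma walk_dist n x y : walk e n x y -> walk e (graph_dist e x y) x y.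
Proof.
move=> xy; have ex : exists n, `[< walk e n x y >] by exists n; apply/asboolP.
suff [] : walk e (graph_dist e x y) x y /\
  forall m, walk e m x y -> (graph_dist e x y <= m)%N by [].
apply: (@xgetPex _ 0%N (fun n => walk e n x y /\
  forall m, walk e m x y -> (n <= m)%N)); exists (ex_minn ex).
case: ex_minnP => k /asboolP xyk kmin; split=> // m xym.
by apply: kmin; apply/asboolP.
Qed.

Lemma distxx x : graph_dist e x x = 0%N.
Proof. by apply/eqP; rewrite -leqn0; apply: dist_le; exact: walk0. Qed.

Lemma eq_graph_dist x y x' y' :
  (forall n, walk e n x y <-> walk e n x' y') ->
  graph_dist e x y = graph_dist e x' y'.
Proof.
move=> xx'; rewrite /graph_dist; congr xget; apply/seteqP.
by split=> n [/xx' xn nmin]; split=> // m /xx' /nmin.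
Qed.

Lemma distC x y : symmetric e -> graph_dist e x y = graph_dist e y x.
Proof. by move=> eC; apply: eq_graph_dist => n; split; exact: walk_rev. Qed.

Hypothesis e_conn : forall x y, exists n, walk e n x y.

Lemma dist_walk x y : walk e (graph_dist e x y) x y.
Proof. by have [n] := e_conn x y; exact: walk_dist. Qed.

Lemma dist_triangle x y z :
  (graph_dist e x z <= graph_dist e x y + graph_dist e y z)%N.
Proof. by apply: dist_le; apply: walk_cat; exact: dist_walk. Qed.

(** Cut a shortest walk after [k] steps; the triangle inequality forces both pieces to be
    shortest. *)
Lemma dist_between x y k : (k <= graph_dist e x y)%N ->
  exists z, graph_dist e x z = k /\ (graph_dist e x z + graph_dist e z y =
    graph_dist e x y)%N.
Proof.
move=> kxy; have := dist_walk x y; rewrite -{1}(subnKC kxy).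
move=> /walk_split[z /dist_le xz /dist_le zy]; exists z.
by have := dist_triangle x z y; lia.
Qed.

End GraphDistance.

Lemma walk_map (T T' : Type) (e : rel T) (e' : rel T') (f : T -> T') n x y :
  (forall x y, e x y -> e' (f x) (f y)) ->
  walk e n x y -> walk e' n (f x) (f y).
Proof.
move=> fe; elim: n x => [|n IHn] x.
  by move=> xy; rewrite (walk0_eq xy); exact: walk0.
by move=> /walkSP[z xz /IHn zy]; apply/walkSP; exists (f z) => //; exact: fe.
Qed.

(** Double the inequality for Gromov products at the base point [w] to clear the fractions; [K] is a
    natural number bounding $2\delta$. *)
Lemma gromov_four_point (R : realType) (T : Type) (d : T -> T -> nat) :
  gromov_hyperbolic (fun x y => (d x y)%:R : R) ->
  exists K, forall x y z w,
    (d x z + d y w <= maxn (d x y + d z w) (d y z + d x w) + K)%N.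
Proof.
move=> [delta dP]; exists (Num.bound (2 * `|delta|)) => x y z w.
have {}dP := dP w x y z.
have dK : 2 * delta <= (Num.bound (2 * `|delta|))%:R.
  apply: le_trans (ltW (archi_boundP _)); last by rewrite mulr_ge0.
  by rewrite ler_pM2l// ler_norm.
move: (Num.bound _) dK => K dK; rewrite addn_maxl leq_max.
move: dP; rewrite lerBlDr ge_min /gromov_product => /orP[] dP; apply/orP.
  by left; rewrite -(ler_nat R) !natrD; lra.
by right; rewrite -(ler_nat R) !natrD; lra.
Qed.

(** * Symmetry, group action and local finiteness of the cusped graph *)

Section CuspedGraph.
Context (G : groupType) (P : group_pair G) (S : {fset G}).
Hypothesis S_compat : compatible P S.
Local Open Scope group_scope.

HB.instance Definition _ := gen_eqMixin (cusped_vertex P).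
HB.instance Definition _ := gen_choiceMixin (cusped_vertex P).

Local Notation vertex := (cusped_vertex P).
Local Notation e := (cusped_graph P S).
Local Notation Sgen i := [pred s in S | s \in P i].
Local Notation word_rel i := (fun g h : G => g^-1 * h \in Sgen i).

Lemma SgenV i s : (s^-1 \in Sgen i) = (s \in Sgen i).
Proof.
have SV x : x \in Sgen i -> x^-1 \in Sgen i.
  rewrite !inE => /andP[xS xi]; rewrite gpredV xi andbT.
  by case: S_compat => _ + _ _; apply.
by apply/idP/idP => /SV //; rewrite invgK.
Qed.

Lemma word_relC i : symmetric (word_rel i).
Proof. by move=> g h; rewrite -SgenV invgM invgK. Qed.

Lemma word_walk_mul i n k g h :
  walk (word_rel i) n g h -> walk (word_rel i) n (k * g) (k * h).
Proof.
apply: walk_map => {}g {}h; rewrite invgM -mulgA mulKg //.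
Qed.

Lemma word_walkV i n x :
  walk (word_rel i) n 1 x -> walk (word_rel i) n 1 x^-1.
Proof.
move=> /(word_walk_mul x^-1); rewrite mulg1 mulVg.
exact: (walk_rev (@word_relC i)).
Qed.

Lemma word_distV i x : word_dist (Sgen i) 1 x^-1 = word_dist (Sgen i) 1 x.
Proof.
apply: eq_graph_dist => n; split; last exact: word_walkV.
by move=> /word_walkV; rewrite invgK.
Qed.

(** The elements reached from 1 form a subgroup containing the generators, to which the minimality
    in [generates] applies. *)
Lemma word_walk_ex i x : x \in P i -> exists n, walk (word_rel i) n 1 x.
Proof.
pose K : {pred G} := fun x => `[< exists n, walk (word_rel i) n 1 x >].
have KM : mulg_closed K.
  move=> g h /asboolP[m gm] /asboolP[n hn]; apply/asboolP; exists (m + n)%N.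
  apply: walk_cat gm _; rewrite -{1}[g]mulg1; exact: word_walk_mul.
have KV : invg_closed K.
  by move=> g /asboolP[m gm]; apply/asboolP; exists m; exact: word_walkV.
have K1 : 1 \in K by apply/asboolP; exists 0%N; exact: walk0.
pose KG : groupClosed G := HB.pack_for (groupClosed G) K
  (isInvClosed.Build G K KV) (isMul1Closed.Build G K K1)
  (isMulClosed.Build G K KM).
case: S_compat => _ _ _ /(_ i)[_ /(_ KG) +] xi.
move=> /(_ _ _ xi) => KGx; apply/asboolP; apply: KGx => s si.
by apply/asboolP; exists 1%N; apply: walk1; rewrite invg1 mul1g.
Qed.

Lemma coset_memP i g h :
  lcoset g (P i) =i lcoset h (P i) <-> g^-1 * h \in P i.
Proof.
split=> [gh|ghP x]; first by rewrite -mem_lcoset gh mem_lcoset mulVg gpred1.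
rewrite !mem_lcoset -[in LHS](mulVKg h x) mulgA gpredMl//.
Qed.

Lemma cusped_graph_Ground g y : e (Ground P g) y ->
  (exists2 s, s \in S & y = Ground P (g * s)) \/
  (exists i, y = Horo g i 0).
Proof.
move=> /asboolP; move: (erefl (Ground P g)); move: {-2}(Ground P g) => x.
move=> /[swap]; case: x y / => [{}g' h i j gh|g' i n|g' i n|g' h i n].
- by move=> /= [gg']; subst g'; left; exists (g^-1 * h); rewrite ?mulVKg.
- by case: n => [|n] //= [<-]; right; exists i.
- by [].
- by case: n.
Qed.

Lemma cusped_graph_Horo g i n y : e (Horo g i n) y ->
  [\/ y = Horo g i n.+1, y = cvertex g i n |
      exists h, [/\ y = Horo h i n, g^-1 * h \in P i &
        (word_dist (Sgen i) 1 (g^-1 * h) <= 2 ^ n.+1)%N]].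
Proof.
move=> /asboolP; move: (erefl (Horo g i n)); move: {-2}(Horo g i n) => x.
move=> /[swap]; case: x y / => [{}g' h j k gh|g' j m|g' j m|g' h j m].
- by [].
- by case: m => [|m] //= [-> -> ->]; constructor 1.
- by move=> [-> -> ->]; constructor 2.
case: m => [|m] //= _ _ /coset_memP gh ghn [gg' ii' nn'].
by subst g' j m; constructor 3; exists h.
Qed.

Lemma cusped_graphC : symmetric e.
Proof.
suff eC x y : e x y -> e y x by move=> x y; apply/idP/idP; exact: eC.
move=> /asboolP xy; apply/asboolP; case: x y / xy => [g h i j|g i n|g i n|].
- move=> gh; apply: GroundEdge; case: S_compat => _ /(_ _ gh) + _ _.
  by rewrite invgM invgK.
- exact: DownEdge.
- exact: UpEdge.
move=> g h i n n0 gh ghP ghn; apply: HoroEdge => //; first by rewrite eq_sym.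
by rewrite -[h^-1 * g]invgK word_distV invgM invgK.
Qed.

Definition vertex_act (k : G) (x : vertex) : vertex :=
  match x with
  | Ground g => Ground P (k * g)
  | Horo g i n => Horo (k * g) i n
  end.

Lemma vertex_act_cvertex k g i n :
  vertex_act k (cvertex g i n) = cvertex (k * g) i n.
Proof. by case: n. Qed.

Lemma vertex_actM k l x : vertex_act (k * l) x = vertex_act k (vertex_act l x).
Proof. by case: x => [g|g i n] /=; rewrite mulgA. Qed.

Lemma vertex_act1 x : vertex_act 1 x = x.
Proof. by case: x => [g|g i n] /=; rewrite mul1g. Qed.

Lemma cusped_graph_act k x y : e x y -> e (vertex_act k x) (vertex_act k y).
Proof.
move=> /asboolP xy; apply/asboolP; case: x y / xy => [g h i j|g i n|g i n|].
- rewrite !vertex_act_cvertex => gh; apply: GroundEdge.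
  by rewrite invgM -mulgA mulKg.
- by rewrite !vertex_act_cvertex; exact: UpEdge.
- by rewrite !vertex_act_cvertex; exact: DownEdge.
move=> g h i n n0 gh ghP ghn; rewrite !vertex_act_cvertex.
have kgh : (k * g)^-1 * (k * h) = g^-1 * h by rewrite invgM -mulgA mulKg.
apply: HoroEdge => //; last by rewrite kgh.
  by apply: contra_neq gh; exact: mulgI.
by apply/coset_memP; rewrite kgh; exact/coset_memP.
Qed.

Lemma cusped_dist_act k x y :
  graph_dist e (vertex_act k x) (vertex_act k y) = graph_dist e x y.
Proof.
apply: eq_graph_dist => n; split; last exact/walk_map/cusped_graph_act.
move=> /(walk_map (@cusped_graph_act k^-1)); rewrite -!vertex_actM mulVg.
by rewrite !vertex_act1.
Qed.

Definition height (x : vertex) : nat := if x is Horo _ _ n then n.+1 else 0%N.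

Lemma height_cvertex g i n : height (cvertex g i n) = n.
Proof. by case: n. Qed.

Lemma height_walk n x y : walk e n x y -> (height y <= height x + n)%N.
Proof.
elim: n x => [|n IHn] x; first by move=> /(@walk0_eq _ _ _ _)->; rewrite addn0.
move=> /walkSP[z xz /IHn zy]; apply: leq_trans zy _.
suff : (height z <= (height x).+1)%N by lia.
case: x xz => [g /cusped_graph_Ground[[s _ ->]|[i ->]]|] //.
move=> g i k /cusped_graph_Horo[->|->|[h [-> _ _]]] //=.
by rewrite height_cvertex; lia.
Qed.

Definition in_horoball (g : G) (i : gp_index P) (x : vertex) : bool :=
  if x is Horo h j _ then (j == i) && (g^-1 * h \in P i) else false.

(** [Horo g i k] has height [k.+1], more than the [n] steps of the walk, and a horoball can be left
    only through height 0. *)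
Lemma horoball_walk n g i k y :
  walk e n (Horo g i k) y -> (n <= k)%N -> in_horoball g i y.
Proof.
elim: n g k => [|n IHn] g k.
  by move=> /(@walk0_eq _ _ _ _)<- _; rewrite /= eqxx mulVg gpred1.
move=> /walkSP[z /cusped_graph_Horo[->|->|[h [-> gh _]]]].
- by move=> /IHn zy nk; apply: zy; lia.
- by case: k => [//|k] /IHn zy nk; apply: zy.
move=> /IHn zy nk; have {zy} := zy (ltnW nk).
case: (y) => // h' j m /= /andP[-> hh'] /=.
by rewrite -[h'](mulVKg h) mulgA gpredM.
Qed.

Fixpoint words (m : nat) : seq G :=
  if m is m'.+1 then [seq a * b | a <- words m', b <- 1 :: enum_fset S]
  else [:: 1].

Lemma wordsS m :
  words m.+1 = [seq a * b | a <- words m, b <- 1 :: enum_fset S].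
Proof. by []. Qed.

Lemma words_incr m n : (m <= n)%N -> {subset words m <= words n}.
Proof.
move=> /subnKC <-; elim: (n - m)%N => [|k IHk] x xm; first by rewrite addn0.
rewrite addnS wordsS; apply/allpairsP; exists (x, 1).
by rewrite /= mem_head mulg1; split=> //; exact: IHk.
Qed.

Lemma words_walk i n x : walk (word_rel i) n 1 x -> x \in words n.
Proof.
elim: n x => [|n IHn] x; first by move=> /(@walk0_eq _ _ _ _)<-; rewrite inE.
rewrite -addn1 => wx; have [y /IHn yn /walkSP[z + zx]] := walk_split wx.
rewrite (walk0_eq zx) {z zx} addn1 inE wordsS => /andP[yx _]; apply/allpairsP.
exists (y, y^-1 * x) => /=.
by rewrite mulVKg inE yx orbT.
Qed.

(** A finite list containing all neighbours of [x] if [x] has height at most [h]. A horizontal edge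
    at [Horo g i n] has word length at most [2 ^ n.+1], and [n.+1] is the height, so [words (2 ^ h)]
    suffices; its size does not depend on [x]. *)
Definition neighbours (h : nat) (x : vertex) : seq vertex :=
  match x with
  | Ground g => [seq Ground P (g * s) | s <- enum_fset S] ++
                [seq Horo g i 0 | i <- enum (gp_index P)]
  | Horo g i n => [:: Horo g i n.+1, cvertex g i n &
                      [seq Horo (g * a) i n | a <- words (2 ^ h)]]
  end.

Lemma mem_neighbours h x y :
  (height x <= h)%N -> e x y -> y \in neighbours h x.
Proof.
case: x => [g _ /cusped_graph_Ground[[s sS ->]|[i ->]]|g i n nh].
- by rewrite mem_cat map_f.
- by rewrite mem_cat map_f ?orbT// mem_enum.
move=> /cusped_graph_Horo[->|->|[k [-> gk kn]]]; rewrite !inE ?eqxx ?orbT//.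
apply/orP; right; apply/orP; right; apply/mapP; exists (g^-1 * k).
  have [m gkm] := word_walk_ex gk; have := words_walk (walk_dist gkm).
  apply: words_incr; apply: leq_trans kn _.
  by rewrite leq_exp2l.
by rewrite mulVKg.
Qed.

Lemma size_neighbours h x : (size (neighbours h x) <=
  size (enum_fset S) + #|gp_index P| + (size (words (2 ^ h))).+2)%N.
Proof.
case: x => [g|g i n]; rewrite /neighbours.
  by rewrite size_cat !size_map cardT enumT leq_addr.
by rewrite -[size _]/(size (map _ _)).+2 size_map leq_addl.
Qed.

(** One step may raise the height by one, whence [h.+1]. Keeping [x] among its successors covers
    shorter walks as well. *)
Fixpoint ball (h : nat) (n : nat) (x : vertex) : seq vertex :=
  if n is n'.+1 then flatten [seq ball h.+1 n' y | y <- x :: neighbours h x]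
  else [:: x].

Lemma mem_ball h n k x y :
  (height x <= h)%N -> (k <= n)%N -> walk e k x y -> y \in ball h n x.
Proof.
elim: n h k x y => [|n IHn] h k x y xh.
  by rewrite leqn0 => /eqP-> /(@walk0_eq _ _ _ _)->; rewrite inE.
case: k => [_ /(@walk0_eq _ _ _ _)<-|k kn /walkSP[z xz zy]].
  rewrite /= mem_cat (IHn _ 0%N)//; [exact: leqW|exact: walk0].
apply/flattenP; exists (ball h.+1 n z); last first.
  apply: (IHn _ k) => //.
  by apply: leq_trans (height_walk (walk1 xz)) _; rewrite addn1.
by rewrite map_f// inE mem_neighbours ?orbT.
Qed.

Lemma size_ball n h : exists N, forall x, (size (ball h n x) <= N)%N.
Proof.
elim: n h => [|n IHn] h; first by exists 1%N.
have [N NP] := IHn h.+1.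
pose N' := (size (enum_fset S) + #|gp_index P| + (size (words (2 ^ h))).+2)%N.
exists (N'.+1 * N)%N => x.
have szb (s : seq vertex) :
    (size (flatten [seq ball h.+1 n y | y <- s]) <= size s * N)%N.
  by elim: s => //= y s IHs; rewrite size_cat mulSn leq_add.
apply: leq_trans (szb _) _; rewrite leq_mul2r ltnS size_neighbours.
exact: orbT.
Qed.

End CuspedGraph.

(** * Acyclicity of Rips complexes of the cusped graph and of its horoballs *)

Section CuspedAcyclicity.
Context (G : groupType) (P : group_pair G) (S : {fset G}).
Hypothesis S_compat : compatible P S.
Local Notation e := (cusped_graph P S).
Local Notation d := (graph_dist e).
Local Notation Sgen i := [pred s in S | s \in P i].

Hypothesis e_conn : forall x y, exists n, walk e n x y.
Context (K : nat).
Hypothesis four_point : forall x y z w,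
  (d x z + d y w <= maxn (d x y + d z w) (d y z + d x w) + K)%N.
Context (R : nzRingType).

(** The estimate in [near_fill] gives [2 * K + 1]; one more unit pays for the error in
    [below_dist]. *)
Definition near (x y : cusped_vertex P) : Prop := (d x y <= 2 * K.+1)%N.

Definition near_in_horoball (g : G) (i : gp_index P) (x y : cusped_vertex P) :=
  [/\ in_horoball g i x, in_horoball g i y & near x y].

Lemma near_refl x : near x x.
Proof. by rewrite /near distxx. Qed.

Lemma near_sym x y : near x y -> near y x.
Proof. by rewrite /near distC//; exact: cusped_graphC. Qed.

(** Contract towards a ground vertex [w]: a far vertex [v] is replaced by the vertex [z] at distance
    [K.+1] on a geodesic to [w]. In the four-point inequality for [u], [v], [z], [w] both
    alternatives bound [d u z] by [2 * K + 1]. *)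
Lemma near_fill n c : c \in chain_span R (clique near n) -> bd c = 0 ->
  exists2 y, y \in chain_span R (clique near n.+1) & bd y = c.
Proof.
pose w := Ground P 1%g.
apply: (@clique_fill _ _ near (fun v => d v w) w (2 * K.+1)).
- exact: near_sym.
- exact: near_refl.
- by [].
move=> v _ vw.
have [|z [vz zw]] := dist_between e_conn (x := v) (y := w) (k := K.+1).
  by lia.
exists z; split; [lia|exact: near_refl|move=> u uv uw].
by have := four_point u v z w; rewrite /near in uv *; lia.
Qed.

(** The vertices of the horoball which, once raised to level [M], equal [Horo g i M] or are adjacent
    to it: [2 ^ M.+1] is the bound for horizontal edges at height [M.+1]. *)
Definition below (g : G) (i : gp_index P) (M : nat) (x : cusped_vertex P) :=
  if x is Horo h j m then
    [&& in_horoball g i x, (m <= M)%N &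
        (word_dist (Sgen i) 1 (g^-1 * h)%g <= 2 ^ M.+1)%N]
  else false.

Lemma below_in_horoball g i M x : below g i M x -> in_horoball g i x.
Proof. by case: x => // h j m /and3P[]. Qed.

Lemma below_incr g i M N x : (M <= N)%N -> below g i M x -> below g i N x.
Proof.
move=> MN; case: x => // h j m /and3P[xi mM gh].
apply/and3P; split; [exact: xi|exact: leq_trans MN|apply: leq_trans gh _].
by rewrite leq_exp2l.
Qed.

Lemma below_fin g i (F : seq (cusped_vertex P)) :
  {in F, forall x, in_horoball g i x} ->
  exists M, {in F, forall x, below g i M x}.
Proof.
elim: F => [|x F IHF] Fi; first by exists 0%N.
have [|M MF] := IHF; first by move=> y yF; apply: Fi; rewrite inE yF orbT.
have [N xN] : exists N, below g i N x.
  have := Fi x (mem_head _ _); case: (x) => // h j m xi.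
  (* The exponential bound is met because $k<2^k$. *)
  exists (m + word_dist (Sgen i) 1 (g^-1 * h)%g)%N.
  apply/and3P; split; [exact: xi|exact: leq_addr|set k := word_dist _ _ _].
  apply: leq_trans (ltnW (ltn_expl k (ltnSn 1))) _.
  by rewrite leq_exp2l// ltnW// ltnS leq_addl.
exists (maxn M N) => y; rewrite inE => /orP[/eqP->|/MF].
  exact: below_incr (leq_maxr _ _) xN.
exact/below_incr/leq_maxl.
Qed.

Lemma walk_up g i m k : walk e k (Horo g i m) (Horo g i (m + k)).
Proof.
elim: k => [|k IHk]; first by rewrite addn0; exact: walk0.
rewrite -addn1; apply: walk_cat IHk (walk1 _); apply/asboolP.
by rewrite addn1 addnS; exact: (UpEdge S g i (m + k).+1).
Qed.

(** Heights grow by at most one along an edge, which gives the lower bound. For the upper one, climb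
    to level [M] and use at most one horizontal edge. *)
Lemma below_dist g i M h m : below g i M (Horo h i m) ->
  (M - m <= d (Horo h i m) (Horo g i M) <= (M - m).+1)%N.
Proof.
move=> /and3P[/andP[_ gh] mM ghM]; apply/andP; split.
  have := height_walk (dist_walk e_conn (Horo h i m) (Horo g i M)).
  by rewrite /=; lia.
have up := walk_up h i m (M - m); rewrite subnKC// in up.
have [<-|hg] := eqVneq h g.
  by apply: leq_trans (dist_le up) _.
rewrite -addn1; apply: dist_le; apply: walk_cat up (walk1 _).
apply/asboolP; apply: (HoroEdge (n := M.+1)) => //.
  by apply/coset_memP; rewrite -gpredV invgM invgK.
by rewrite -(word_distV S_compat) invgM invgK.
Qed.

(* A vertex high above the horoball plays the role of its point at infinity:
   up to an error of 1, distances to it are differences of heights.  Hence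
   moving the lowest vertex upwards contracts the horoball. *)
Lemma horoball_fill g i n c :
  c \in chain_span R (clique (near_in_horoball g i) n) -> bd c = 0 ->
  exists2 y, y \in chain_span R (clique (near_in_horoball g i) n.+1) & bd y = c.
Proof.
move=> /chain_span_fin[F FQ cF] bdc.
have [|M MF] := @below_fin g i F.
  by move=> x /FQ[s [_ rs] xs]; have [] := rs x x xs xs.
pose r x y := [/\ below g i M x, below g i M y & near x y].
(* The rank counts the levels left to climb. If there are at most [(2 * K).+1] of them, [below_dist]
   puts the vertex within [2 * K.+1] of the apex. *)
have [|||||y yr bdy] := @clique_fill R _ r
    (fun x => M.+1 - height x)%N (Horo g i M) (2 * K).+1 _ _ _ _ n c _ bdc.
- by move=> x y [xM yM xy]; split=> //; exact: near_sym.
- split; try exact: near_refl.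
    rewrite /= eqxx mulVg gpred1 leqnn /word_dist.
    by rewrite distxx.
  by rewrite /= eqxx mulVg gpred1 leqnn /word_dist distxx.
- move=> v [vM _ _]; case: v vM => // h j m vM vlow; split=> //.
    by rewrite /= eqxx mulVg gpred1 leqnn /word_dist distxx.
  have /andP[/eqP ji _] : in_horoball g i (Horo h j m).
    exact: below_in_horoball vM.
  subst j; have /andP[_ vw] := below_dist vM; rewrite /near.
  by rewrite /= in vlow; lia.
- move=> v [vM _ _]; case: v vM => // h j m vM vhigh.
  have /andP[/eqP ji gh] : in_horoball g i (Horo h j m).
    exact: below_in_horoball vM.
  subst j; have /and3P[_ mM ghM] := vM; rewrite /= in vhigh.
  have v'M : below g i M (Horo h i (m + K.+1)).
    by rewrite /= eqxx gh ghM andbT; lia.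
  exists (Horo h i (m + K.+1)); split; first by rewrite /=; lia.
    by split=> //; exact: near_refl.
  move=> u [uM _ uv]; case: u uM uv => // h' j m' uM uv um; split=> //.
  have /andP[/eqP ji _] : in_horoball g i (Horo h' j m').
    exact: below_in_horoball uM.
  (* The error of 1 in [below_dist] costs one unit in either alternative: the distance to the raised
     vertex is at most [2 * K + 2]. *)
  subst j; have := four_point (Horo h' i m') (Horo h i m)
    (Horo h i (m + K.+1)) (Horo g i M).
  have /andP[_ uw] := below_dist uM; have /andP[vw _] := below_dist vM.
  have /andP[_ v'w] := below_dist v'M; have vv' := dist_le (walk_up h i m K.+1).
  have /and3P[_ m'M _] := uM.
  by rewrite /near /= in um uv *; lia.
- apply: chain_span_sub cF => s [[sn rs] sF]; split=> // x y xs ys.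
  by have [_ _ xy] := rs x y xs ys; split=> //; exact/MF/sF.
exists y => //; apply: chain_span_sub yr => s [sn rs]; split=> // x z xs zs.
by have [/below_in_horoball xi /below_in_horoball zi] := rs x z xs zs; split.
Qed.

(** If the first vertex is low, the clique lies in a ball of bounded cardinality; if it is higher
    than the diameter, every other vertex stays in its horoball. *)
Lemma near_small : exists N, forall s n, clique near n s -> uniq s ->
  (N < size s)%N ->
  exists g i, {in s, forall x, in_horoball g i x}.
Proof.
have [N NP] := size_ball P S (2 * K.+1) (2 * K.+1).
exists N => -[//|x s] n [_ rs] us; rewrite ltnNge => sN.
have [xlow|] := leqP (height x) (2 * K.+1).
  case/negP: sN; apply: leq_trans (NP x); apply: uniq_leq_size => // y ys.
  apply: (mem_ball S_compat xlow (rs x y (mem_head _ _) ys)).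
  exact: dist_walk.
case: x rs {us sN} => [//|g i k] rs klow; exists g, i => y ys.
have xy := rs _ _ (mem_head _ _) ys.
apply: (horoball_walk (dist_walk e_conn (Horo g i k) y)).
by rewrite /= in klow; apply: leq_trans xy _; rewrite -ltnS.
Qed.

End CuspedAcyclicity.

(** * The retraction onto peripheral tuples *)

Section ConeHomotopy.
Context (R : nzRingType) (T : choiceType).
Context (phi : {linear chain R T -> chain R T}).
Hypothesis phi_nil : phi (tuple_chain [::]) = tuple_chain [::].
Hypothesis phi_bd : forall c, bd (phi c) = phi (bd c).

(** The apex is the first entry of the tuple, which makes the construction commute with the vertex
    maps that [phi] respects and keeps it inside cosets. *)
Definition cone_homotopy : chain R T -> chain R T :=
  crec 0 (fun x s c => cone x (phi (tuple_chain (x :: s)) -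
    tuple_chain (x :: s) - c)).
HB.instance Definition _ := GRing.Linear.on cone_homotopy.
Local Notation h := cone_homotopy.

Lemma cone_homotopy_cons x s : h (tuple_chain (x :: s)) =
  cone x (phi (tuple_chain (x :: s)) - tuple_chain (x :: s) -
    h (bd (tuple_chain (x :: s)))).
Proof. exact: crec_cons. Qed.

(** The chain that is coned off is a cycle by the identity one degree lower, so its cone fills
    it. *)
Lemma bd_cone_homotopy c : bd (h c) + h (bd c) = phi c - c.
Proof.
move: c; apply: (chain_ext (f := (@bd R T \o h) \+ (h \o @bd R T))
  (f' := phi \- idfun)).
elim/tuple_ind => [|x s IHs] /=.
  by rewrite bd_nil phi_nil subrr /h crec_nil !linear0 addr0.
rewrite cone_homotopy_cons bd_cone; set b := bd (tuple_chain (x :: s)).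
have bh : bd (h b) = phi b - b.
  rewrite -[LHS]addr0 -(linear0 h) -(bd_bd (tuple_chain (x :: s))).
  apply: (chain_span_ext (f := (@bd R T \o h) \+ (h \o @bd R T))
    (f' := phi \- idfun)) (bd_cons_in R x s) => t [ts _].
  exact: IHs.
have -> : bd (phi (tuple_chain (x :: s)) - tuple_chain (x :: s) - h b) = 0.
  by rewrite !linearB /= phi_bd bh -/b subrr.
by rewrite linear0 subr0 subrK.
Qed.

Lemma cone_homotopy_carried (p : pred T) :
  (forall s, all p s -> phi (tuple_chain s) \in chain_span R (all p)) ->
  forall s, all p s -> h (tuple_chain s) \in chain_span R (all p).
Proof.
move=> phip; elim/tuple_ind => [|x s IHs] ps.
  by rewrite /h crec_nil rpred0.
rewrite cone_homotopy_cons.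
suff : phi (tuple_chain (x :: s)) - tuple_chain (x :: s) -
    h (bd (tuple_chain (x :: s))) \in chain_span R (all p).
  apply: chain_span_homo => t pt; rewrite /= coneE mem_chain_span//=.
  by rewrite pt andbT; case/andP: ps.
rewrite !rpredB ?phip ?mem_chain_span//.
apply: chain_span_homo (bd_cons_in R x s) => t [ts tS] /=.
by apply: IHs => //; apply/allP => y /tS; exact: (allP ps).
Qed.

Lemma cone_homotopy_natural (f : T -> T) :
  (forall c, cmap f (phi c) = phi (cmap f c)) ->
  forall c, cmap f (h c) = h (cmap f c).
Proof.
move=> phif; apply: crec_natural => [|x s c] /=; first exact: linear0.
by rewrite cmap_cone !linearB /= phif !cmapE.
Qed.

End ConeHomotopy.

(** * Equivariant lift to the cusped graph and return to tuples *)

Section PeripheralContraction.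
Context (R : numFieldType) (G : groupType) (P : group_pair G) (S : {fset G}).
Hypothesis S_compat : compatible P S.
Local Notation e := (cusped_graph P S).
Local Notation d := (graph_dist e).
Local Notation IG := (G * gp_index P)%type.
Local Notation vertex := (cusped_vertex P).

Hypothesis e_conn : forall x y, exists n, walk e n x y.
Context (K : nat).
Hypothesis four_point : forall x y z w,
  (d x z + d y w <= maxn (d x y + d z w) (d y z + d x w) + K)%N.
Local Notation near := (near S K).
Local Notation near_in_horoball := (near_in_horoball S K).

Definition in_coset (g : G) (i : gp_index P) (x : IG) : bool :=
  (x.2 == i) && (g^-1 * x.1 \in P i)%g.

Definition left_act (k : G) (x : IG) : IG := ((k * x.1)%g, x.2).

Lemma in_coset_act k g i x :
  in_coset (k * g)%g i (left_act k x) = in_coset g i x.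
Proof. by rewrite /in_coset /= invgM -mulgA mulKg. Qed.

Lemma in_coset_head g i x s : all (in_coset g i) (x :: s) ->
  in_coset g i x /\ all (in_coset x.1 x.2) (x :: s).
Proof.
move=> gi; have /andP[xi _] := gi; split=> //.
apply: sub_all gi => y /andP[/eqP yi gy]; have /andP[/eqP xi' gx] := xi.
rewrite /in_coset yi xi' eqxx /= -[y.1](mulVKg g) mulgA gpredM//.
by rewrite -gpredV invgM invgK.
Qed.

Lemma in_horoball_coset g i x (v : vertex) :
  in_coset g i x -> in_horoball x.1 x.2 v -> in_horoball g i v.
Proof.
move=> /andP[/eqP xi gx]; case: v => // h j n /andP[/eqP-> xh].
rewrite /= xi eqxx /= -[h](mulVKg x.1) mulgA gpredM//.
by rewrite -xi.
Qed.

Lemma in_horoball_act k g i (v : vertex) :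
  in_horoball (k * g)%g i (vertex_act k v) = in_horoball g i v.
Proof. by case: v => //= h j n; rewrite invgM -mulgA mulKg. Qed.

Lemma near_act k (x y : vertex) :
  near (vertex_act k x) (vertex_act k y) <-> near x y.
Proof. by rewrite /near cusped_dist_act. Qed.

(** The flag [b] tells whether the tuple is peripheral. Only the horoball over [P i] itself occurs,
    because chains are translated before filling. *)
Definition filler_span (b : bool) (i : gp_index P) (n : nat) :
    Defs.subspace (chain R vertex) :=
  chain_span R (if b then clique (near_in_horoball 1%g i) n else clique near n).

Definition filler b i n (c : chain R vertex) : chain R vertex :=
  xget 0 (fun y => y \in filler_span b i n.+1 /\ bd y = c).

Lemma fillerP b i n c : c \in filler_span b i n -> bd c = 0 ->
  filler b i n c \in filler_span b i n.+1 /\ bd (filler b i n c) = c.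
Proof.
move=> cb bdc.
apply: (@xgetPex _ 0 (fun y => y \in filler_span b i n.+1 /\ bd y = c)).
case: b cb => cb.
  have [y yn bdy] := horoball_fill S_compat e_conn four_point cb bdc.
  by exists y.
have [y yn bdy] := near_fill S_compat e_conn four_point cb bdc.
by exists y.
Qed.

(* Translating to the representative whose first entry is in [1 * I] makes the
   arbitrary choice in [filler] equivariant. *)
Definition lift_step (x : IG) (s : seq IG) (c : chain R vertex) :=
  cmap (vertex_act x.1) (filler (all (in_coset x.1 x.2) (x :: s)) x.2 (size s)
    (cmap (vertex_act x.1^-1%g) c)).

Definition lift_chain : chain R IG -> chain R vertex :=
  crec (tuple_chain [::]) lift_step.
HB.instance Definition _ := GRing.Linear.on lift_chain.

(** Quantifying over all cosets that contain [s] makes the carrier monotone in [s], as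
    [crec_carried] requires. *)
Definition lift_carrier (n : nat) (s : seq IG) (t : seq vertex) : Prop :=
  clique near n t /\
  forall g i, all (in_coset g i) s -> all (in_horoball g i) t.

Lemma cmap_act_comp k l (c : chain R vertex) :
  cmap (vertex_act k) (cmap (vertex_act l) c) = cmap (vertex_act (k * l)%g) c.
Proof. by rewrite -cmap_comp; apply: eq_cmap => x; rewrite /= vertex_actM. Qed.

Lemma cmap_act1 (c : chain R vertex) : cmap (vertex_act 1%g) c = c.
Proof. by rewrite (eq_cmap (@vertex_act1 _ _)) cmap_id. Qed.

Lemma lift_step_carried x s c :
  c \in chain_span R (lift_carrier (size s) (x :: s)) -> bd c = 0 ->
  lift_step x s c \in chain_span R (lift_carrier (size s).+1 (x :: s)) /\
  bd (lift_step x s c) = c.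
Proof.
move=> cQ bdc; rewrite /lift_step.
set b := all _ _; set c' := cmap _ c.
have c'b : c' \in filler_span b x.2 (size s).
  move: cQ; apply: chain_span_homo => t [[tn tr] th] /=; rewrite cmapE.
  apply: mem_chain_span; case: ifP => bT; split; rewrite ?size_map//.
    move=> _ _ /mapP[u ut ->] /mapP[v vt ->].
    have tx : all (in_horoball x.1 x.2) t by exact: th.
    split; last by apply/near_act; exact: tr.
      by rewrite -(mulVg x.1) in_horoball_act; exact: (allP tx).
    by rewrite -(mulVg x.1) in_horoball_act; exact: (allP tx).
  by move=> _ _ /mapP[u ut ->] /mapP[v vt ->]; apply/near_act; exact: tr.
have bdc' : bd c' = 0 by rewrite -cmap_bd bdc linear0.
have [yb bdy] := fillerP c'b bdc'; split; last first.
  by rewrite -cmap_bd bdy cmap_act_comp mulgV cmap_act1.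
move: yb; apply: chain_span_homo => t tb /=; rewrite cmapE.
apply: mem_chain_span; split.
  split; first by rewrite size_map; move: tb; case: ifP => _ [].
  move=> _ _ /mapP[u ut ->] /mapP[v vt ->]; apply/near_act.
  by move: tb; case: ifP => _ [_ tr]; have := tr u v ut vt; [case|].
(* Lying in some coset forces the flag [b], so the filling was chosen in a horoball. *)
move=> g i /in_coset_head[xi bT]; rewrite -/b in bT; rewrite bT in tb.
apply/allP => _ /mapP[u ut ->]; apply: in_horoball_coset xi _.
rewrite -[X in in_horoball X]mulg1 in_horoball_act.
by have [_ tr] := tb; have [] := tr u u ut ut.
Qed.

Lemma lift_chain_carried s :
  lift_chain (tuple_chain s) \in chain_span R (lift_carrier (size s) s) /\
  bd (lift_chain (tuple_chain s)) = lift_chain (bd (tuple_chain s)).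
Proof.
move: s; apply: crec_carried; last exact: lift_step_carried.
- move=> n s t u ts [un uh]; split=> // g i gs; apply: uh.
  by apply/allP => x /ts; exact: (allP gs).
- by apply: mem_chain_span; split=> //; split.
- exact: bd_nil.
Qed.

Lemma lift_chain_bd c : bd (lift_chain c) = lift_chain (bd c).
Proof.
move: c; apply: (chain_ext (f := @bd R vertex \o lift_chain)
  (f' := lift_chain \o @bd R IG)) => s.
exact: (lift_chain_carried s).2.
Qed.

Lemma lift_chain_act k c :
  cmap (vertex_act k) (lift_chain c) = lift_chain (cmap (left_act k) c).
Proof.
apply: crec_natural => [|x s {}c] /=; first by rewrite cmapE.
rewrite /lift_step size_map !cmap_act_comp.
rewrite -[left_act k x :: _]/(map _ (x :: s)) all_map.
rewrite (eq_all (in_coset_act k x.1 x.2)) [_.2]/=.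
(* Since $(kx)^{-1}k=x^{-1}$, [filler] is applied to the same chain on both sides. *)
by rewrite invgM -mulgA mulVg mulg1.
Qed.

Context (i0 : gp_index P).

(** Ground vertices carry no index and receive the arbitrary [i0]. They lie in no horoball, so
    [in_coset_footpoint] is unaffected. *)
Definition footpoint (v : vertex) : IG :=
  match v with Ground g => (g, i0) | Horo g i _ => (g, i) end.

Lemma footpoint_act k (v : vertex) :
  footpoint (vertex_act k v) = left_act k (footpoint v).
Proof. by case: v. Qed.

Lemma in_coset_footpoint g i (v : vertex) :
  in_horoball g i v -> in_coset g i (footpoint v).
Proof. by case: v. Qed.

Definition retract : chain R IG -> chain R IG :=
  @alternate R _ \o cmap footpoint \o lift_chain.
HB.instance Definition _ := GRing.Linear.on retract.

Lemma retract_nil : retract (tuple_chain [::]) = tuple_chain [::].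
Proof. by rewrite /retract /= [lift_chain _]crec_nil cmapE alternate_nil. Qed.

Lemma retract_bd c : bd (retract c) = retract (bd c).
Proof. by rewrite /retract /= alternate_bd -cmap_bd lift_chain_bd. Qed.

Lemma retract_act k c :
  cmap (left_act k) (retract c) = retract (cmap (left_act k) c).
Proof.
rewrite /retract /= alternate_natural -lift_chain_act -!cmap_comp.
by congr alternate; apply: eq_cmap => v; rewrite /= footpoint_act.
Qed.

Lemma alternate_footpoint_in g i t : all (in_horoball g i) t ->
  alternate (cmap footpoint (tuple_chain t)) \in
    chain_span R (all (in_coset g i)).
Proof.
move=> th; rewrite cmapE; have [+ _] := alternate_carried R (map footpoint t).
apply: chain_span_sub => u [_ ut]; apply/allP => x /ut /mapP[v vt ->].
by apply: in_coset_footpoint; exact: (allP th).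
Qed.

Lemma retract_in_coset g i s : all (in_coset g i) s ->
  retract (tuple_chain s) \in chain_span R (all (in_coset g i)).
Proof.
move=> gs; have [sQ _] := lift_chain_carried s.
apply: (chain_span_homo (f := @alternate R _ \o cmap footpoint)) sQ => t [_ th].
exact/alternate_footpoint_in/th.
Qed.

(** A long tuple of vertices in the lift either repeats an entry, and then so does its image, which
    [alternate] kills, or lies in one horoball by [near_small]. *)
Lemma retract_large : exists N, forall s, (N < size s)%N ->
  retract (tuple_chain s) \in
    chain_span R (fun t => exists g i, all (in_coset g i) t).
Proof.
have [N NP] := near_small S_compat e_conn K; exists N => s Ns.
have [sQ _] := lift_chain_carried s.
apply: (chain_span_homo (f := @alternate R _ \o cmap footpoint)) sQ => t.
move=> [tn th].
have [ut|nut] := boolP (uniq t); last first.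
  rewrite -[_ (tuple_chain t)]/(alternate (cmap footpoint (tuple_chain t))).
  rewrite cmapE alternate_repetition ?rpred0//.
  by apply/negP => /map_uniq; exact/negP.
have [|g [i gi]] := NP t _ tn ut; first by case: tn => ->.
have /allP/alternate_footpoint_in := gi.
by apply: chain_span_sub => u ui; exists g, i.
Qed.

End PeripheralContraction.

(** * Vanishing of relative cohomology *)

Section SimplexChains.
Context (R : realType) (G : groupType) (P : group_pair G).
Local Notation IG := (G * gp_index P)%type.
Local Notation St := (St R P).

Lemma bd_faces (T : choiceType) (s : seq T) :
  bd (tuple_chain s) = \sum_(j < size s)
    (-1) ^+ j *: tuple_chain (take j s ++ drop j.+1 s) :> chain R T.
Proof.
elim: s => [|x s IHs]; first by rewrite bd_nil big_ord0.
rewrite bd_cons IHs big_ord_recl; congr (_ + _).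
  by rewrite expr0 scale1r /= drop0.
rewrite linear_sum -sumrN; apply: eq_bigr => j _.
by rewrite linearZ /= coneE exprS mulN1r scaleNr.
Qed.

Lemma val_face k (j : 'I_k.+2) (s : simplex P k.+1) :
  val (face j s) = take j (val s) ++ drop j.+1 (val s).
Proof.
have ss : size (val s) = k.+2 by exact: size_tuple.
have x0 := tnth s ord0.
have sz : size (take j (val s) ++ drop j.+1 (val s)) = k.+1.
  rewrite size_cat size_drop size_take ss ltn_ord; have := ltn_ord j; lia.
apply: (@eq_from_nth _ x0) => [|i]; first by rewrite size_tuple.
rewrite size_tuple => ik; rewrite -[i]/(val (Ordinal ik)) -tnth_nth.
rewrite tnth_mktuple (tnth_nth x0) /= nth_cat size_take ss ltn_ord /bump.
have [ij|ji] := ltnP i j; first by rewrite nth_take// leqNgt ij.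
by rewrite nth_drop add1n addSn subnKC.
Qed.

Definition simplex_chain k : St k -> chain R IG :=
  fglift (fun s => tuple_chain (val s)).
HB.instance Definition _ k :=
  GRing.isLinear.Build R (St k) (chain R IG) _ (@simplex_chain k)
    (fglift_linear _).

Lemma simplex_chainE k (s : simplex P k) :
  simplex_chain (Defs.basis R s) = tuple_chain (val s).
Proof. by rewrite /simplex_chain liftU scale1r. Qed.

(** Projection to a single degree; [insub] fails on every other length. Together with
    [simplex_chain] it transports operators on [chain] to [St k]. *)
Definition chain_simplex k : chain R IG -> St k :=
  clift (fun s => oapp (fun t : simplex P k => Defs.basis R t) 0 (insub s)).
HB.instance Definition _ k := GRing.Linear.on (@chain_simplex k).

Lemma chain_simplexE k (s : simplex P k) :
  chain_simplex k (tuple_chain (val s)) = Defs.basis R s.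
Proof. by rewrite /chain_simplex cliftE valK. Qed.

Lemma chain_simplex_size k s :
  size s != k.+1 -> chain_simplex k (tuple_chain s) = 0.
Proof. by move=> sk; rewrite /chain_simplex cliftE insubN. Qed.

Lemma chain_simplexP k (A : chain R IG -> Prop) (s : seq IG) :
  (size s != k.+1 -> A (tuple_chain s)) ->
  (forall t : simplex P k, A (tuple_chain (val t))) -> A (tuple_chain s).
Proof.
move=> As At; have [sk|/As//] := eqVneq (size s) k.+1.
by have := At (@Tuple k.+1 _ s (introT eqP sk)).
Qed.

Lemma simplex_chainK k x : chain_simplex k (simplex_chain x) = x.
Proof.
move: x; apply: St_ext => [||s]; first exact: (linearP (@chain_simplex k \o
  @simplex_chain k)).
  by [].
by rewrite simplex_chainE chain_simplexE.
Qed.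

Lemma chain_simplex_bd k c :
  chain_simplex k (bd c) = St_boundary (chain_simplex k.+1 c).
Proof.
move: c; apply: (chain_ext (f := @chain_simplex k \o @bd R IG)
  (f' := @St_boundary R G P k \o @chain_simplex k.+1)) => s.
apply: (@chain_simplexP k.+1 (fun c => chain_simplex k (bd c) =
  St_boundary (chain_simplex k.+1 c))) => [sk|t].
  rewrite chain_simplex_size// /St_boundary linear0.
  apply: (chain_span_ext (f := @chain_simplex k) (f' := \0)) (bd_in R s).
  move=> t [ts _]; rewrite /= chain_simplex_size//.
  by apply: contraNneq sk; rewrite -ts => ->.
rewrite chain_simplexE St_boundary_basis bd_faces size_tuple linear_sum /=.
apply: eq_bigr => j _.
by rewrite linearZ /= -val_face chain_simplexE.
Qed.

Lemma simplex_chain_bd k (x : St k.+1) :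
  simplex_chain (St_boundary x) = bd (simplex_chain x).
Proof.
move: x; apply: St_ext => [||s].
- exact: (linearP (@simplex_chain k \o @St_boundary R G P k)).
- exact: (linearP (@bd R IG \o @simplex_chain k.+1)).
rewrite St_boundary_basis simplex_chainE bd_faces size_tuple linear_sum /=.
by apply: eq_bigr => j _; rewrite linearZ /= simplex_chainE val_face.
Qed.

Lemma simplex_chain_in k (x : St k) :
  simplex_chain x \in chain_span R (fun s => size s = k.+1).
Proof.
rewrite -[x]freeg_sumE linear_sum rpred_sum// => s _.
rewrite [_ << _ *g s >>]liftU rpredZ// mem_chain_span//.
exact: size_tuple.
Qed.

Lemma val_simplex_act k g (s : simplex P k) :
  val (simplex_act g s) = map (left_act g) (val s).
Proof.
have -> : val s = map (tnth s) (enum 'I_k.+1) by rewrite map_tnth_enum.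
by rewrite -map_comp.
Qed.

Lemma simplex_chain_act k g (x : St k) :
  simplex_chain (St_act g x) = cmap (left_act g) (simplex_chain x).
Proof.
move: x; apply: St_ext => [||s].
- exact: (linearP (@simplex_chain k \o @St_act R G P k g)).
- exact: (linearP (cmap (left_act g) \o @simplex_chain k)).
by rewrite St_act_basis !simplex_chainE cmapE val_simplex_act.
Qed.

Lemma chain_simplex_act k g c :
  chain_simplex k (cmap (left_act g) c) = St_act g (chain_simplex k c).
Proof.
move: c; apply: (chain_ext (f := @chain_simplex k \o cmap (left_act g))
  (f' := @St_act R G P k g \o @chain_simplex k)) => s.
apply: (@chain_simplexP k (fun c => chain_simplex k (cmap (left_act g) c) =
  St_act g (chain_simplex k c))) => [sk|t].
  by rewrite cmapE !chain_simplex_size ?size_map// /St_act linear0.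
by rewrite cmapE -val_simplex_act !chain_simplexE St_act_basis.
Qed.

Lemma peripheral_simplexP k (s : simplex P k) :
  peripheral_simplex s <-> exists g i, all (in_coset g i) (val s).
Proof.
split=> [[i si]|[g [i gs]]].
  exists (tnth s ord0).1, i; apply/allP => _ /tnthP[j ->].
  by have [sj1 sj2] := si j; rewrite /in_coset sj1 eqxx.
exists i => j; have sgi l : in_coset g i (tnth s l).
  by apply: (allP gs); exact: mem_tnth.
have /andP[/eqP-> gj] := sgi j; have /andP[_ g0] := sgi ord0; split=> //.
exact: lcoset_trans g0 gj.
Qed.

Lemma chain_simplex_St' k c :
  c \in chain_span R (fun s => exists g i, all (@in_coset G P g i) s) ->
  chain_simplex k c \in St' R P k.
Proof.
apply: chain_span_homo => s gs.
have [sk|sk] := eqVneq (size s) k.+1; last first.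
  by rewrite [_ (tuple_chain s)](chain_simplex_size sk) rpred0.
pose t : simplex P k := @Tuple k.+1 _ s (introT eqP sk).
rewrite [_ (tuple_chain s)](chain_simplexE t); apply: mem_span; exists t => //.
exact/peripheral_simplexP.
Qed.

End SimplexChains.

(** * Homotopies induced on the relative complex *)

Section RelativeHomotopy.
Local Open Scope quotient_scope.
Context (R : realType) (G : groupType) (P : group_pair G) (k : nat).
Local Notation IG := (G * gp_index P)%type.
Context (h : {linear chain R IG -> chain R IG}).
Hypothesis h_act : forall g c,
  cmap (left_act g) (h c) = h (cmap (left_act g) c).
Hypothesis h_in_coset : forall g i s, all (@in_coset G P g i) s ->
  h (tuple_chain s) \in chain_span R (all (@in_coset G P g i)).

Definition St_homotopy (x : St R P k) : St R P k.+1 :=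
  chain_simplex k.+1 (h (simplex_chain x)).

Lemma St_homotopy_linear : linear St_homotopy.
Proof.
exact: (linearP (@chain_simplex R G P k.+1 \o h \o @simplex_chain R G P k)).
Qed.

Lemma St_homotopy_St' :
  {homo St_homotopy : x / x \in St' R P k >-> x \in St' R P k.+1}.
Proof.
apply: span_homo => [|_ [s /peripheral_simplexP[g [i gs]] ->]].
  exact: St_homotopy_linear.
rewrite /St_homotopy simplex_chainE; apply: chain_simplex_St'.
by apply: chain_span_sub (h_in_coset gs) => t gt; exists g, i.
Qed.

Definition rel_homotopy : St_rel R P k -> St_rel R P k.+1 :=
  quot_map (St' R P k.+1) St_homotopy.

Lemma rel_homotopyE x :
  rel_homotopy (\pi_(St_rel R P k) x) = \pi_(St_rel R P k.+1) (St_homotopy x).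
Proof.
by apply: quot_mapE; [exact: St_homotopy_linear|exact: St_homotopy_St'].
Qed.

Lemma rel_homotopy_linear : linear rel_homotopy.
Proof.
move=> a x y; rewrite -[x]reprK -[y]reprK.
rewrite -pi_quot_linear !rel_homotopyE St_homotopy_linear.
exact: pi_quot_linear.
Qed.

Lemma rel_homotopy_act g x :
  rel_homotopy (rel_act g x) = rel_act g (rel_homotopy x).
Proof.
rewrite -[x]reprK rel_actE !rel_homotopyE rel_actE /St_homotopy.
by rewrite simplex_chain_act -h_act chain_simplex_act.
Qed.

End RelativeHomotopy.

(** * Cocycles of high degree are coboundaries *)

Section Vanishing.
Local Open Scope quotient_scope.

Lemma pi_quot_eq0 (R : pzRingType) (V : lmodType R) (W : Defs.subspace V) x :
  x \in W -> \pi_(quot_space W) x = 0.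
Proof.
have pi0 : \pi_(quot_space W) 0 = 0.
  by apply: (addrI (\pi_(quot_space W) 0)); rewrite -pi_quotD !addr0.
by move=> xW; rewrite -pi0; apply/eqP; rewrite -quot_space_eq subr0.
Qed.

(** On the quotient [h] induces $H$ with $\partial H+H\partial=-1$ in degree [m]. A cocycle $F$
    kills the first term, so $F=-F\circ H\circ\partial$ is the coboundary of $-F\circ H$. *)
Lemma rel_cohomology_eq0 (R : realType) (G : groupType) (P : group_pair G)
    (h : {linear chain R (G * gp_index P)%type ->
      chain R (G * gp_index P)%type})
    (m : nat) (V : bounded_module R G) (x : rel_cohomology P V m) :
  (forall g c, cmap (left_act g) (h c) = h (cmap (left_act g) c)) ->
  (forall g i s, all (@in_coset G P g i) s ->
    h (tuple_chain s) \in chain_span R (all (@in_coset G P g i))) ->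
  (forall s, size s = m.+1 ->
    bd (h (tuple_chain s)) + h (bd (tuple_chain s)) + tuple_chain s \in
      chain_span R (fun t => exists g i, all (@in_coset G P g i) t)) ->
  (0 < m)%N -> x = 0.
Proof.
(* A primitive lives one degree lower, so [m] has to be a successor. *)
case: m x => // k x h_act h_in h_large _.
rewrite -[x]reprK; move: (repr x) => {x} z; apply: pi_quot_eq0; apply/asboolP.
have /asboolP[[lF eF] dF] := valP z; set F := val z in lF eF dF *.
pose H := rel_homotopy (k := k) h.
pose FH : St_rel R P k -> V := F \o H.
have FHc : is_cochain FH.
  split=> [a y y'|g y]; rewrite /FH /=.
    by rewrite /H (rel_homotopy_linear h_in) lF.
  by rewrite /H (rel_homotopy_act h_act h_in) eF.
(* The summand 0 gives the witness the shape treated by [is_cochainP]. *)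
exists (-1 *: FH + 0); first exact/is_cochainP/is_cochain0.
have FD y y' : F (y + y') = F y + F y' by rewrite -[y]scale1r lF !scale1r.
have F0 : F 0 = 0 by apply: (addrI (F 0)); rewrite -FD !addr0.
have homotopy y : H (rel_boundary y) + y + rel_boundary (rel_homotopy h y) = 0.
  rewrite -[y]reprK rel_boundaryE /H !rel_homotopyE// rel_boundaryE -!pi_quotD.
  move: (repr y) => {}y; apply: pi_quot_eq0.
  rewrite /St_homotopy simplex_chain_bd -chain_simplex_bd.
  rewrite -[X in _ + X + _](simplex_chainK y) addrAC [X in X + _]addrC.
  rewrite -!linearD /=.
  apply: chain_simplex_St'; move: (simplex_chain_in y).
  apply: (chain_span_homo (f := (@bd R _ \o h) \+ (h \o @bd R _) \+ idfun)).
  exact: h_large.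
apply/funext => y; rewrite -[RHS]/(-1 *: F (H (rel_boundary y)) + 0).
rewrite addr0 scaleN1r; apply/eqP; rewrite -addr_eq0 addrC; apply/eqP.
rewrite -F0 -(homotopy y) !FD.
by rewrite -[F (rel_boundary _)]/(coboundary F _) dF addr0.
Qed.

End Vanishing.

Theorem theorem7p6 (R : realType) (G : groupType) (P : group_pair G)
    (hP : relatively_hyperbolic R P) :
  exists n : nat, forall m : nat, (n < m)%N ->
    forall V : bounded_module R G, forall x : rel_cohomology P V m, x = 0.
Proof.
have [_ _ [S S_compat [e_conn /gromov_four_point[K four_point]]]] := hP.
pose i0 : gp_index P := enum_val (Ordinal (gp_nonempty P)).
have [N NP] := retract_large R S_compat e_conn four_point i0.
exists N => m Nm V x.
pose h := cone_homotopy (@retract R G P S K i0).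
have bdh c : bd (h c) + h (bd c) = retract S K i0 c - c.
  by apply: bd_cone_homotopy; [exact: retract_nil|exact: retract_bd].
apply: (rel_cohomology_eq0 (h := h)).
- by move=> g c; apply: cone_homotopy_natural; exact: retract_act.
- by move=> g i s; apply: cone_homotopy_carried; exact: retract_in_coset.
(* The sum reduces to the retraction of [s], which is peripheral because the length [m.+1] of [s]
   exceeds [N]. *)
- by move=> s sm; rewrite bdh subrK; apply: NP; rewrite sm leqW.
- exact: leq_ltn_trans Nm.
Qed.
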